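(* Assume that $\nabla f$ is $\ell$-Lipschitz continuous for some $\ell>0$, that $\delta:[t_0,+\infty)\to(0,+\infty)$ is continuously differentiable and nondecreasing, and that $$\alpha>3,\qquad \beta\ge 0,\qquad \tfrac12>\theta>\tfrac{1}{\alpha-1},\qquad \sup_{t\ge t_0}\frac{t\dot\delta(t)}{\delta(t)}<\frac{1-2\theta}{\theta}.$$ Let $(x,\lambda):[t_0,+\infty)\to\mathcal X\times\mathcal Y$ be a solution of the dynamical system (DS) and let $(x_*,\lambda_* )\in\mathbb S$. Then, as $t\to+\infty$, $$\|\nabla f(x(t))-\nabla f(x_* )\|=o\left(\frac{1}{\sqrt t\,\sqrt[4]{\delta(t)}}\right)\quad\text{and}\quad\|A^*(\lambda(t)-\lambda_* )\|=o\left(\frac{1}{\sqrt t\,\sqrt[4]{\delta(t)}}\right).$$ Consequently, as $t\to+\infty$, $$\|\nabla_x\mathcal L(x(t),\lambda(t))\|=\|\nabla f(x(t))+A^*\lambda(t)\|=o\left(\frac{1}{\sqrt t\,\sqrt[4]{\delta(t)}}\right),$$ while $$\|\nabla_\lambda\mathcal L(x(t),\lambda(t))\|=\|Ax(t)-b\|=\mathcal O\left(\frac{1}{t^2\delta(t)}\right).$$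
   Context: Let $\mathcal X,\mathcal Y$ be real Hilbert spaces; $\mathcal X\times\mathcal Y$ carries the product inner product and norm. Let $f:\mathcal X\to\mathbb R$ be convex and continuously differentiable, $A:\mathcal X\to\mathcal Y$ a continuous linear operator with adjoint $A^*$, and $b\in\mathcal Y$. The problem is to minimize $f(x)$ subject to $Ax=b$. The Lagrangian is $\mathcal L(x,\lambda)=f(x)+\langle\lambda,Ax-b\rangle$. $\mathbb S$ denotes the set of saddle points of $\mathcal L$ (primal-dual optimal solutions), equivalently the set of $(x_*,\lambda_* )\in\mathcal X\times\mathcal Y$ with $\nabla f(x_* )+A^*\lambda_*=0$ and $Ax_*=b$; it is assumed nonempty. Given $t_0>0$, $\alpha>0$, $\theta>0$, $\beta\ge0$, a function $\delta$, and initial data $(x_0,\lambda_0),(\dot x_0,\dot\lambda_0)\in\mathcal X\times\mathcal Y$, the dynamical system (DS) is, for $t\ge t_0$, $$\ddot x(t)+\frac\alpha t\dot x(t)+\delta(t)\nabla f(x(t))+\delta(t)A^*\big(\lambda(t)+\theta t\dot\lambda(t)\big)+\delta(t)\beta A^*(Ax(t)-b)=0,$$ $$\ddot\lambda(t)+\frac\alpha t\dot\lambda(t)-\delta(t)\Big(A\big(x(t)+\theta t\dot x(t)\big)-b\Big)=0,$$ with $(x(t_0),\lambda(t_0))=(x_0,\lambda_0)$ and $(\dot x(t_0),\dot\lambda(t_0))=(\dot x_0,\dot\lambda_0)$. A solution is a twice continuously differentiable pair $(x,\lambda)$ satisfying this. *)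

(* Defs.v *)
From HB Require Import structures.
From mathcomp Require Import all_boot all_order all_algebra sesquilinear.
From mathcomp Require Import all_classical all_reals all_analysis.

Set Implicit Arguments.
Unset Strict Implicit.
Unset Printing Implicit Defensive.

Import Order.TTheory GRing.Theory Num.Theory.
Import numFieldNormedType.Exports.

Local Open Scope classical_set_scope.
Local Open Scope ring_scope.

(* lets the Landau notations f =o_F g be used at F = +oo *)
Canonical pinfty_filter_on (R : numFieldType) :=
  FilterType (pinfty_nbhs R) (@filter_filter _ _ proper_pinfty_nbhs).

HB.mixin Record CompleteNormedModule_isHilbert (R : realType) V
    & CompleteNormedModule R V := {
  inner : {dot V for (@idfun R)} ;
  inner_normE : forall u : V, inner u u = `|u| ^+ 2
}.

#[short(type="hilbertType")]
HB.structure Definition Hilbert (R : realType) :=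
  {V of CompleteNormedModule R V & CompleteNormedModule_isHilbert R V}.

Notation "''[' u , v ]" := (inner u v) : ring_scope.

(* The Riesz representatives exist and are unique when f is differentiable at x
   (resp. A is linear and continuous), so [get] picks the intended vector. *)
Definition gradient (R : realType) (X : hilbertType R) (f : X -> R) (x : X) : X :=
  get [set g | forall h, 'd f x h = '[g, h]].

Definition adjoint (R : realType) (X Y : hilbertType R) (A : X -> Y) (y : Y) : X :=
  get [set z | forall x, '[A x, y] = '[x, z]].

Definition lagrangian (R : realType) (X Y : hilbertType R)
    (f : X -> R) (A : X -> Y) (b : Y) (x : X) (lam : Y) : R :=
  f x + '[lam, A x - b].

Definition saddle_points (R : realType) (X Y : hilbertType R)
    (f : X -> R) (A : X -> Y) (b : Y) : set (X * Y) :=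
  [set z | forall (x : X) (lam : Y),
    lagrangian f A b z.1 lam <= lagrangian f A b z.1 z.2 /\
    lagrangian f A b z.1 z.2 <= lagrangian f A b x z.2].

(* Derivatives relative to D: for D = [t0, +oo[ these are one-sided at t0 and
   the values of u outside D play no role. *)
Definition derivable_in (R : realType) (V : normedModType R) (D : set R)
    (u : R -> V) (t : R) : Prop :=
  cvg ((fun s => (s - t)^-1 *: (u s - u t)) @ within D t^').

Definition derive_in (R : realType) (V : normedModType R) (D : set R)
    (u : R -> V) (t : R) : V :=
  lim ((fun s => (s - t)^-1 *: (u s - u t)) @ within D t^').

Definition C1_on (R : realType) (V : normedModType R) (D : set R)
    (u : R -> V) : Prop :=
  (forall t, D t -> derivable_in D u t) /\ {within D, continuous (derive_in D u)}.

Definition C2_on (R : realType) (V : normedModType R) (D : set R)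
    (u : R -> V) : Prop :=
  C1_on D u /\ C1_on D (derive_in D u).

Definition DS_solution (R : realType) (X Y : hilbertType R)
    (f : X -> R) (A : X -> Y) (b : Y)
    (t0 alpha theta beta : R) (delta : R -> R)
    (x0 : X) (lam0 : Y) (dx0 : X) (dlam0 : Y)
    (x : R -> X) (lam : R -> Y) : Prop :=
  let D : set R := `[t0, +oo[%classic in
  let dx := derive_in D x in
  let ddx := derive_in D dx in
  let dlam := derive_in D lam in
  let ddlam := derive_in D dlam in
  [/\ C2_on D x, C2_on D lam,
    forall t, t0 <= t ->
      ddx t + (alpha / t) *: dx t + delta t *: gradient f (x t)
        + delta t *: adjoint A (lam t + (theta * t) *: dlam t)
        + (delta t * beta) *: adjoint A (A (x t) - b) = 0,
    forall t, t0 <= t ->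
      ddlam t + (alpha / t) *: dlam t
        - delta t *: (A (x t + (theta * t) *: dx t) - b) = 0 &
    [/\ x t0 = x0, lam t0 = lam0, dx t0 = dx0 & dlam t0 = dlam0]].

(* Main.v *)
Require Import Defs.
From HB Require Import structures.
From mathcomp Require Import all_boot all_order all_algebra sesquilinear.
From mathcomp Require Import all_classical all_reals all_analysis.
From mathcomp Require Import ring lra.

Set Implicit Arguments.
Unset Strict Implicit.
Unset Printing Implicit Defensive.

Import Order.TTheory GRing.Theory Num.Theory.
Import numFieldNormedType.Exports.

Local Open Scope classical_set_scope.
Local Open Scope ring_scope.

(** Why the rates hold.  Write p = x - xs, r = lam - lams, g for the difference
    of the gradients at x and xs, q for the adjoint of A applied to r, and v for
    the pair of velocities.  At a saddle point, grad f (xs) is minus the adjoint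
    of A applied to lams, and A xs = b; so the system becomes an equation in p
    and r, and A x - b = A p.

    The Lyapunov function E is theta^2 t^2 delta(t) times the gap of the
    augmented Lagrangian, plus |(p, r) + theta t v|^2 / 2, plus
    (alpha theta - theta - 1) |(p, r)|^2 / 2.  In its derivative all coupling
    terms between x and lam cancel.  Cocoercivity of grad f (Baillon-Haddad) and
    the growth bound on delta then leave at most minus a multiple of
    t delta |g|^2 + t |v|^2.  Hence p, r and t v are bounded, and
    t delta |g|^2 and t |v|^2 have finite integral.

    The equation for lam says that t delta (A p + theta t A p') is the
    derivative of m = t lam' + (alpha - 1) r, which is bounded.  The
    vector w = theta t^2 delta A p - m satisfies w' = - a (w + m) with a >= 0,
    so |w| cannot grow once it exceeds the bound of |m|.  This gives
    |A p| = O (1 / (t^2 delta)).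

    Pairing the equation for x with t q exhibits t delta |q|^2 / 4 as minus the
    derivative of a function B, up to terms controlled by E and by
    the estimate on A p.  So some combination V = k E + B + N / t is bounded
    below, and V' is at most minus a multiple of
    t delta (|g|^2 + |q|^2) + t |v|^2.

    The passage from integrals to pointwise rates is the same for g and q; let h be one
    of them.  With phi = t sqrt(delta) |h|^2, the growth of phi is at most a
    constant times t delta |h|^2 + t |v|^2, because h is a Lipschitz function of
    the trajectory; so phi + C V is nonincreasing for large C.  On the other hand
    sqrt(delta) phi = t delta |h|^2 has finite integral and delta is bounded
    below, so phi takes arbitrarily small values at late times.
    Monotonicity of phi + C V then keeps phi small from such a time on, since V
    converges.  Because g need not be differentiable along the trajectory,
    monotonicity is derived from one-sided difference quotients
    (dini_nonincreasing), and every integral argument is replaced by a monotone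
    function.

    In a Hilbert space the representatives that define gradients and adjoints
    exist by Riesz_representation. *)

(** * Inner products and Riesz representation *)
Section Inner.
Context {R : realType} {X : hilbertType R}.
Implicit Types (u v w : X) (a b : R).

Lemma innerC u v : '[u, v] = '[v, u].
Proof. by rewrite hermC /= expr0 mul1r. Qed.
Lemma innerDl u v w : '[u + v, w] = '[u, w] + '[v, w].
Proof. exact: linearDl. Qed.
Lemma innerDr u v w : '[w, u + v] = '[w, u] + '[w, v].
Proof. exact: linearDr. Qed.
Lemma innerNl u w : '[- u, w] = - '[u, w].
Proof. exact: linearNl. Qed.
Lemma innerNr u w : '[w, - u] = - '[w, u].
Proof. exact: linearNr. Qed.
Lemma innerBl u v w : '[u - v, w] = '[u, w] - '[v, w].
Proof. exact: linearBl. Qed.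
Lemma innerBr u v w : '[w, u - v] = '[w, u] - '[w, v].
Proof. exact: linearBr. Qed.
Lemma innerZl a u w : '[a *: u, w] = a * '[u, w].
Proof. exact: linearZl_LR. Qed.
Lemma innerZr a u w : '[w, a *: u] = a * '[w, u].
Proof. exact: linearZr_LR. Qed.
Lemma inner0l w : '[0 : X, w] = 0. Proof. exact: linear0l. Qed.
Lemma inner0r w : '[w, 0 : X] = 0. Proof. exact: linear0r. Qed.

(** Expanding the squared norms of |v| u + |u| v and |v| u - |u| v gives both
    signs at once. *)
Lemma CauchySchwarz_inner u v : `|'[u, v]| <= `|u| * `|v|.
Proof.
have [->|u0] := eqVneq u 0; first by rewrite inner0l !normr0 mul0r.
have [->|v0] := eqVneq v 0; first by rewrite inner0r !normr0 mulr0.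
have nu : 0 < `|u| by rewrite normr_gt0.
have nv : 0 < `|v| by rewrite normr_gt0.
have uv : 0 < `|u| * `|v| by rewrite mulr_gt0.
have h1 : 0 <= `| `|v| *: u + `|u| *: v| ^+ 2 by exact: sqr_ge0.
have h2 : 0 <= `| `|v| *: u - `|u| *: v| ^+ 2 by exact: sqr_ge0.
rewrite -inner_normE ?(innerDl, innerDr, innerZl, innerZr, innerNl, innerNr) in h1.
rewrite -inner_normE ?(innerDl, innerDr, innerZl, innerZr, innerNl, innerNr) in h2.
rewrite (innerC v u) !inner_normE in h1 h2.
rewrite ler_norml; apply/andP; split; rewrite -(ler_pM2l uv); nra.
Qed.

Lemma inner_ge0 u : 0 <= '[u, u].
Proof. by rewrite inner_normE sqr_ge0. Qed.

Lemma inner_lincomb_ge0 u v a b :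
  0 <= a ^+ 2 * '[u, u] + 2 * a * b * '[u, v] + b ^+ 2 * '[v, v].
Proof.
have := inner_ge0 (a *: u + b *: v).
rewrite innerDl !innerDr !innerZl !innerZr (innerC v u).
by move: '[u, u] '[u, v] '[v, v] => c d e; lra.
Qed.

End Inner.

#[local] Hint Extern 0 (is_true (0 <= _)) => solve [apply: inner_ge0] : core.

Lemma continuous_linear_le (R : realType) (X Y : normedModType R) (A : {linear X -> Y}) :
  continuous A -> exists2 K, 0 < K & forall x, `|A x| <= K * `|x|.
Proof.
move=> /linear_bounded_continuous/linear_boundedP/pinfty_ex_gt0 [K K0 AK].
by exists K.
Qed.

(** Polarization reduces this to continuity of the norm. *)
Lemma inner_continuous (R : realType) (X : hilbertType R) :
  continuous (fun p : X * X => '[p.1, p.2]).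
Proof.
have -> : (fun p : X * X => '[p.1, p.2]) =
    (fun p => 4^-1 * (`|p.1 + p.2| ^+ 2 - `|p.1 - p.2| ^+ 2)).
  apply/funext => p; rewrite -!inner_normE.
  by rewrite !(innerDl, innerDr, innerNl, innerNr) (innerC p.2 p.1); field.
move=> p; apply: cvgM; first exact: cvg_cst.
have c1 : {for p, continuous (fst : X * X -> X)} by exact: cvg_fst.
have c2 : {for p, continuous (snd : X * X -> X)} by exact: cvg_snd.
have sq (g : X * X -> X) : {for p, continuous g} ->
    (fun p => `|g p| ^+ 2) x @[x --> p] --> `|g p| ^+ 2.
  move=> gc; rewrite expr2; under eq_fun do rewrite expr2.
  by apply: cvgM; apply: cvg_norm.
by apply: cvgB; apply: sq; [apply: cvgD | apply: cvgB].
Qed.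

Lemma is_derive_inner (R : realType) (X : hilbertType R) (u v : R -> X) (t : R)
    (du dv : X) : is_derive t 1 u du -> is_derive t 1 v dv ->
  is_derive t 1 (fun s => '[u s, v s]) ('[du, v t] + '[u t, dv]).
Proof.
move=> [hu eu] [hv ev].
have du' : differentiable u t by apply/derivable1_diffP.
have dv' : differentiable v t by apply/derivable1_diffP.
have Hp : is_diff t (fun s => (u s, v s)) (fun s => ('d u t s, 'd v t s)).
  by apply: is_diff_pair; apply: DiffDef.
have Hb := @diff_bilin R X X R inner (u t, v t) (@inner_continuous _ _).
have db := @differentiable_bilin R X X R inner (u t, v t) (@inner_continuous _ _).
have dc : differentiable ((fun p : X * X => '[p.1, p.2]) \o (fun s => (u s, v s))) t.
  by apply: differentiable_comp.
split; first exact: diff_derivable dc.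
have -> : (fun s => '[u s, v s]) =
  ((fun p : X * X => '[p.1, p.2]) \o (fun s => (u s, v s))) by [].
rewrite deriveE // diff_comp //= Hb.
rewrite (@diff_val _ _ _ _ _ _ _ Hp) /= -!deriveE // eu ev.
by rewrite addrC.
Qed.

Lemma affine_quadratic_ge0_slope0 (R : realFieldType) (a c : R) :
  (forall s, 0 <= s * a + s ^+ 2 * c) -> a = 0.
Proof.
move=> h; have c0 : 0 <= `|c| by [].
have := h (- a / (`|c| + 1)).
have -> : - a / (`|c| + 1) * a + (- a / (`|c| + 1)) ^+ 2 * c =
   a ^+ 2 * (c - `|c| - 1) / (`|c| + 1) ^+ 2 by field; lra.
have c1 : 0 < (`|c| + 1) ^+ 2 by rewrite exprn_gt0 // ltr_wpDl.
rewrite pmulr_lge0 ?invr_gt0 //.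
have := ler_norm c => h1 h2.
have : a ^+ 2 <= 0 by have := sqr_ge0 a; nra.
by move=> h3; apply/eqP; rewrite -sqrf_eq0 eq_le h3 sqr_ge0.
Qed.

(** The representative is the minimizer of J u = |u|^2 / 2 - phi u.  By the
    parallelogram identity, points where J is close to its infimum are close to
    each other, so the sublevel sets of J form a Cauchy filter; at its limit the
    first-order condition is exactly the representation of phi. *)
Lemma Riesz_representation (R : realType) (X : hilbertType R) (phi : X -> R) (K : R) :
  (forall a u v, phi (a *: u + v) = a * phi u + phi v) ->
  (forall u, `|phi u| <= K * `|u|) ->
  exists z, forall u, phi u = '[z, u].
Proof.
move=> lin bnd.
pose J u := '[u, u] / 2 - phi u.
have phiD u v : phi (u + v) = phi u + phi v by have := lin 1 u v; rewrite scale1r mul1r.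
have phi0 : phi 0 = 0 by have := phiD 0 0; rewrite addr0 => h;
  apply: (addrI (phi 0)); rewrite addr0 -h.
have phiZ a u : phi (a *: u) = a * phi u by have := lin a u 0; rewrite !addr0 phi0 addr0.
have Jge u : - (K ^+ 2) / 2 <= J u.
  rewrite /J inner_normE; have := le_trans (ler_norm _) (bnd u).
  by have := sqr_ge0 (`|u| - K); nra.
have Jinf : has_inf (range J).
  split; first by exists (J 0); exists 0.
  by exists (- (K ^+ 2) / 2) => _ [u _ <-].
pose m := inf (range J).
have Jm u : m <= J u by apply: ge_inf; [case: Jinf | exists u].
pose S e := [set u : X | J u < m + e].
pose F := filter_from [set e : R | 0 < e] S.
have FF : ProperFilter F.
  apply: filter_from_proper; last first.
    move=> e /= e0; have [_ [u _ <-] Ju] := inf_adherent e0 Jinf.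
    by exists u.
  apply: filter_from_filter; first by exists 1 => /=.
  move=> i j /= i0 j0; exists (Num.min i j) => /=; first by rewrite lt_min i0.
  move=> u /=; rewrite /S /= => h; split; apply: (lt_le_trans h).
    by rewrite lerD2l ge_min lexx.
  by rewrite lerD2l ge_min lexx orbT.
have para u v : `|u - v| ^+ 2 = 4 * (J u + J v - 2 * J (2^-1 *: (u + v))).
  rewrite /J phiZ phiD -inner_normE.
  rewrite !(innerDl, innerDr, innerNl, innerNr, innerZl, innerZr) (innerC v u).
  by field.
have /cauchy_cvgP FC : cauchy F.
  apply/cauchy_exP => e e0.
  have d0 : 0 < e ^+ 2 / 16 by rewrite divr_gt0 // exprn_gt0.
  have [_ [u _ <-] Ju] := inf_adherent d0 Jinf.
  exists u, (e ^+ 2 / 16) => //= v; rewrite /S /= => Jv.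
  rewrite -ball_normE /= -(@ltr_pXn2r _ 2) ?nnegrE //; last exact: ltW.
  rewrite para; have := Jm (2^-1 *: (u + v)).
  have e20 : 0 < e ^+ 2 by rewrite exprn_gt0.
  rewrite -/m in Ju; lra.
pose z := lim F.
have Fz : F --> z by [].
have Jc : {for z, continuous J}.
  have cphi : {for z, continuous phi}.
    have K0 : 0 < `|K| + 1 by rewrite ltr_wpDl.
    apply/cvgrPdist_lt => e e0.
    have d0 : 0 < e / (`|K| + 1) by rewrite divr_gt0.
    near=> u.
    have -> : phi z - phi u = phi (z - u).
      by rewrite phiD -(scaleN1r u) phiZ mulN1r.
    apply: (le_lt_trans (bnd _)).
    have zu : `|z - u| < e / (`|K| + 1).
      near: u; exact: (@cvgr_dist_lt _ _ _ (nbhs z) _ id z).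
    apply: (@le_lt_trans _ _ ((`|K| + 1) * `|z - u|)).
      by rewrite ler_wpM2r // (le_trans (ler_norm _)) // lerDl.
    by rewrite mulrC -ltr_pdivlMr.
  apply: cvgB => //; apply: cvgM; last exact: cvg_cst.
  have := @cvg_comp _ _ _ (fun u : X => (u, u)) (fun p : X * X => '[p.1, p.2])
    (nbhs z) (nbhs (z, z)) (nbhs ('[z, z] : R)) _ (@inner_continuous R X (z, z)).
  apply; by apply: cvg_pair.
have FJ : J u @[u --> F] --> J z by apply: cvg_comp Fz Jc.
have Jz : J z <= m.
  apply/ler_addgt0Pr => e e0.
  apply: (cvgr_to_le FJ).
  by exists e => //= u; rewrite /S /= => /ltW.
exists z => h.
suff : '[z, h] - phi h = 0 by move/eqP; rewrite subr_eq0 => /eqP.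
apply: (@affine_quadratic_ge0_slope0 _ _ ('[h, h] / 2)) => s.
have := le_trans Jz (Jm (z + s *: h)).
rewrite /J (phiD z (s *: h)) (phiZ s h).
rewrite !(innerDl, innerDr, innerZl, innerZr) (innerC h z).
lra.
Unshelve. all: by end_near. Qed.

(** * Derivatives and monotonicity on the line *)
Lemma dnbhs_shift (R : realType) (t : R) : (fun h => h + t) @ 0^' = t^'.
Proof.
apply/predeqP => P; split.
  move=> /nbhs_ballP [e /= e0 He]; apply/nbhs_ballP; exists e => //= s.
  rewrite -ball_normE /= => ts st.
  have /= := He (s - t); rewrite subrK; apply; last by rewrite subr_eq0.
  by rewrite -ball_normE /= sub0r normrN -normrN opprB.
move=> /nbhs_ballP [e /= e0 He]; apply/nbhs_ballP; exists e => //= h.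
rewrite -ball_normE /= sub0r normrN => he h0; apply: He.
  by rewrite -ball_normE /= opprD addrCA subrr addr0 normrN.
by rewrite -subr_eq0 addrK.
Qed.

Lemma slope_shift (R : realType) (V : normedModType R) (u : R -> V) (t : R) :
  (fun s => (s - t)^-1 *: (u s - u t)) @ t^' =
  (fun h => h^-1 *: ((u \o shift t) (h *: 1) - u t)) @ 0^'.
Proof.
rewrite -dnbhs_shift -fmap_comp; 
have <- : (fun s => (s - t)^-1 *: (u s - u t)) \o (fun h => h + t) =
  (fun h => h^-1 *: ((u \o shift t) (h *: 1) - u t)) by apply/funext => h /=;
  rewrite addrK {3}/GRing.scale /= mulr1.
by [].
Qed.

(** Away from the left end point the relative derivative is the two-sided one;
    only asymptotic statements matter, so all estimates start after t0. *)
Lemma derive_inE (R : realType) (V : normedModType R) (u : R -> V) (t0 t : R) :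
  t0 < t -> derivable_in `[t0, +oo[ u t ->
  is_derive t 1 u (derive_in `[t0, +oo[ u t).
Proof.
move=> t0t; rewrite /derivable_in /derive_in.
have -> : within `[t0, +oo[ t^' = t^'.
  apply/predeqP => P; split; last first.
    move=> H; rewrite /within /=; near=> s => _; near: s; exact: H.
  move=> H; have {}H : \forall s \near t^', `[t0, +oo[%classic s -> P s by exact: H.
  have H2 : \forall s \near t^', t0 <= s.
    by near=> s; apply: ltW; near: s; apply: nbhs_dnbhs; exact: lt_nbhsr.
  near=> s.
  have /= : `[t0, +oo[%classic s -> P s by near: s.
  by apply; rewrite in_itv /= andbT; near: s.
rewrite slope_shift => cv; split => //.
Unshelve. all: by end_near. Qed.

Lemma is_derive_right_le (R : realType) (F : R -> R) (t d : R) :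
  is_derive t 1 F d -> forall e, 0 < e ->
  \forall s \near t^'+, F s - F t <= (d + e) * (s - t).
Proof.
move=> [+ +] e e0; rewrite /derivable /derive -slope_shift => cv dE.
have {}cv : (fun s => (s - t)^-1 *: (F s - F t)) @ t^'+ --> d.
  by apply: cvg_dnbhs_at_right; rewrite -dE.
have cl : (d < d + e) by rewrite ltrDl.
have H := cvgr_le _ cv _ cl.
near=> s.
have st : 0 < s - t by rewrite subr_gt0; near: s; exact: nbhs_right_gt.
rewrite -ler_pdivrMr // mulrC; near: s.
exact: H.
Unshelve. all: by end_near. Qed.

(** If F b > F a + e (b - a), the last point up to which F stays below the line
    of slope e through (a, F a) would be contradicted by the right difference
    quotient there. *)
Lemma dini_nonincreasing (R : realType) (F : R -> R) (a b : R) : a <= b ->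
  (forall t, a <= t -> t <= b -> {for t, continuous F}) ->
  (forall t, a <= t -> t < b -> forall e, 0 < e ->
     \forall s \near t^'+, F s - F t <= e * (s - t)) ->
  F b <= F a.
Proof.
move=> ab Fc Fd; apply/ler_addgt0Pr => e' e'0.
pose e := e' / (b - a + 1).
have ba0 : 0 < b - a + 1 by rewrite ltr_wpDl // subr_ge0.
have e0 : 0 < e by rewrite divr_gt0.
suff Fe : F b <= F a + e * (b - a).
  apply: (le_trans Fe); rewrite lerD2l /e mulrAC ler_pdivrMr //.
  by rewrite ler_pM2l // lerDl.
pose S := [set s | [/\ a <= s, s <= b & F s <= F a + e * (s - a)]].
have Sa : S a by split => //; rewrite subrr mulr0 addr0.
have hS : has_sup S by split; [exists a | exists b => s []].
pose c := sup S.
have ac : a <= c by apply: ub_le_sup => //; case: hS.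
have cb : c <= b by apply: ge_sup; [exists a | move=> s []].
have Sc : F c <= F a + e * (c - a).
  rewrite leNgt; apply/negP => Hc.
  pose H s := F s - (F a + e * (s - a)).
  have Hcont : {for c, continuous H}.
    apply: cvgB; first exact: Fc.
    apply: cvgD; first exact: cvg_cst.
    apply: cvgM; first exact: cvg_cst.
    by apply: cvgB; [exact: cvg_id | exact: cvg_cst].
  have H0 : 0 < H c by rewrite subr_gt0.
  have Hn : nbhs c [set s | 0 < H s] by apply: (cvgr_gt _ Hcont).
  have [d /= d0 Hd] := (nbhs_ballP c [set s | 0 < H s]).1 Hn.
  have [s Ss cs] := sup_adherent d0 hS.
  have sc : s <= c by apply: ub_le_sup => //; case: hS.
  have := Hd s; rewrite -ball_normE /= ger0_norm ?subr_ge0 // => hh.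
  have : 0 < H s by apply: hh; rewrite -/c in cs; lra.
  by rewrite subr_gt0 ltNge; case: Ss => _ _ ->.
move: cb; rewrite le_eqVlt => /orP [/eqP cbE|cb]; first by rewrite -cbE.
have Hn := Fd c ac cb e e0.
suff [s [cs Ss]] : exists s, c < s /\ S s.
  by have := ub_le_sup hS.2 Ss; rewrite leNgt cs.
near c^'+ => s; exists s; split; first by near: s; exact: nbhs_right_gt.
have cs : c < s by near: s; exact: nbhs_right_gt.
split; first by rewrite (le_trans ac) // ltW.
  by near: s; exact: nbhs_right_le.
have : F s - F c <= e * (s - c) by near: s.
lra.
Unshelve. all: by end_near. Qed.

Lemma is_derive_nonincreasing (R : realType) (F dF : R -> R) (a b : R) : a <= b ->
  (forall t, a <= t -> t <= b -> is_derive t 1 F (dF t)) ->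
  (forall t, a <= t -> t <= b -> dF t <= 0) -> F b <= F a.
Proof.
move=> ab Fd dF0; apply: dini_nonincreasing => // t ta tb.
  have := Fd t ta tb; case=> /derivable1_diffP h _.
  exact: differentiable_continuous.
move=> e e0; have := is_derive_right_le (Fd t ta (ltW tb)) e0.
move=> H; near=> s.
have st : 0 <= s - t by rewrite subr_ge0 ltW//; near: s; exact: nbhs_right_gt.
apply: (@le_trans _ _ ((dF t + e) * (s - t))); first by near: s.
by rewrite ler_wpM2r // gerDr dF0 // ltW.
Unshelve. all: by end_near. Qed.

(** The derivative rules for functions written pointwise.  Used as explicit proof
    terms, they build the derivative of a long expression along its structure. *)
Section PointwiseDerivative.
Context {R : realType}.
Implicit Types (f g : R -> R) (t a b : R).

Lemma is_deriveD_pt f g t a b : is_derive t 1 f a -> is_derive t 1 g b ->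
  is_derive t 1 (fun s => f s + g s) (a + b).
Proof. exact: is_deriveD. Qed.

Lemma is_deriveB_pt f g t a b : is_derive t 1 f a -> is_derive t 1 g b ->
  is_derive t 1 (fun s => f s - g s) (a - b).
Proof. exact: is_deriveB. Qed.

Lemma is_deriveM_pt f g t a b : is_derive t 1 f a -> is_derive t 1 g b ->
  is_derive t 1 (fun s => f s * g s) (a * g t + f t * b).
Proof.
move=> fa gb; apply: is_derive_eq (is_deriveM fa gb) _.
by rewrite addrC [in RHS]mulrC.
Qed.

Lemma is_deriveMl_pt (k : R) f t a : is_derive t 1 f a ->
  is_derive t 1 (fun s => k * f s) (k * a).
Proof. exact: is_deriveZ. Qed.

Lemma is_derive_id_pt t : is_derive t 1 (fun s => s) 1.
Proof. exact: is_derive_id. Qed.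

Lemma is_derive_sqr_pt t : is_derive t 1 (fun s => s ^+ 2) (2 * t).
Proof.
have := is_deriveM_pt (is_derive_id_pt t) (is_derive_id_pt t).
by rewrite mul1r mulr1 -mulr2n mulr_natl.
Qed.

Lemma is_deriveV_pt f t a : f t != 0 -> is_derive t 1 f a ->
  is_derive t 1 (fun s => (f s)^-1) (- a / (f t) ^+ 2).
Proof.
move=> f0 [fd fa]; split; first exact: derivableV.
by rewrite deriveV // fa [LHS]mulrC mulrN mulNr.
Qed.

End PointwiseDerivative.

(** * Gradients, adjoints and saddle points *)
Lemma inner_ext (R : realType) (X : hilbertType R) (a b : X) :
  (forall u, '[a, u] = '[b, u]) -> a = b.
Proof.
move=> h; apply/eqP; rewrite -subr_eq0 -normr_eq0 -sqrf_eq0 -inner_normE.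
by rewrite innerBl h subrr.
Qed.

Lemma gradientP (R : realType) (X : hilbertType R) (f : X -> R) (x : X) :
  differentiable f x -> forall h, 'd f x h = '[gradient f x, h].
Proof.
move=> df; apply: (@getPex _ [set g | forall h, 'd f x h = '[g, h]]).
have [K _ bnd] := continuous_linear_le (diff_continuous df).
by apply: Riesz_representation bnd => a u v; rewrite linearP.
Qed.

Lemma gradient_eq (R : realType) (X : hilbertType R) (f : X -> R) (x g : X) :
  differentiable f x -> (forall h, 'd f x h = '[g, h]) -> gradient f x = g.
Proof. by move=> df fg; apply: inner_ext => h; rewrite -gradientP. Qed.

Lemma adjointP (R : realType) (X Y : hilbertType R) (A : {linear X -> Y}) (y : Y) :
  continuous A -> forall x, '[A x, y] = '[x, adjoint A y].
Proof.
move=> /continuous_linear_le [K K0 AK].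
apply: (@getPex _ [set z | forall x, '[A x, y] = '[x, z]]).
have [a u v|u|z hz] := @Riesz_representation R X (fun x => '[A x, y]) (K * `|y|).
- by rewrite linearP innerDl innerZl.
- rewrite mulrAC; apply: (le_trans (CauchySchwarz_inner _ _)).
  by rewrite ler_wpM2r.
by exists z => x; rewrite hz innerC.
Qed.

Lemma adjoint_is_linear (R : realType) (X Y : hilbertType R) (A : {linear X -> Y}) :
  continuous A -> linear (adjoint A).
Proof.
move=> Ac a u v; apply: inner_ext => h; rewrite innerC -adjointP //.
by rewrite innerDr innerZr !adjointP // innerDl innerZl !(innerC h).
Qed.

Lemma adjoint_bounded (R : realType) (X Y : hilbertType R) (A : {linear X -> Y}) K :
  continuous A -> 0 <= K -> (forall x, `|A x| <= K * `|x|) ->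
  forall y, `|adjoint A y| <= K * `|y|.
Proof.
move=> Ac K0 AK y; have [->|n0] := eqVneq (adjoint A y) 0.
  by rewrite normr0 mulr_ge0.
have np : 0 < `|adjoint A y| by rewrite normr_gt0.
rewrite -(ler_pM2l np) -expr2 -inner_normE -adjointP //.
apply: (le_trans (ler_norm _)); apply: (le_trans (CauchySchwarz_inner _ _)).
by rewrite mulrA [_ * K]mulrC ler_wpM2r.
Qed.

Lemma is_derive_gradient (R : realType) (X : hilbertType R) (f : X -> R)
    (u : R -> X) (t : R) (du : X) :
  differentiable f (u t) -> is_derive t 1 u du ->
  is_derive t 1 (fun s => f (u s)) '[gradient f (u t), du].
Proof.
move=> df [hu eu].
have du' : differentiable u t by apply/derivable1_diffP.
have dc : differentiable (f \o u) t by apply: differentiable_comp.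
split; first exact: diff_derivable dc.
have -> : (fun s => f (u s)) = f \o u by [].
by rewrite deriveE // diff_comp //= -(deriveE _ du') eu gradientP.
Qed.

Lemma is_derive_line (R : realType) (X : normedModType R) (x h : X) (t : R) :
  is_derive t 1 (fun s : R => x + s *: h) h.
Proof.
have d1 : is_derive t 1 (fun s : R => s *: h) h.
  have [d e] := is_diff_scalel t h.
  by split; [exact: diff_derivable | rewrite deriveE // e scale1r].
have := @is_deriveD _ _ _ (cst x) (fun s : R => s *: h) t 1 0 h (is_derive_cst _ _ _) d1.
by rewrite add0r.
Qed.

Lemma convex_gradient_le (R : realType) (X : hilbertType R) (f : X -> R) (x y : X) :
  @convex_function R X setT f -> differentiable f x ->
  f x + '[gradient f x, y - x] <= f y.
Proof.
move=> fc df; set h := y - x.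
have fl : is_derive (0 : R) 1 (fun s : R => f (x + s *: h)) '[gradient f x, h].
  have := @is_derive_gradient R X f (fun s => x + s *: h) 0 h.
  rewrite scale0r addr0; apply => //; exact: is_derive_line.
rewrite addrC -lerBrDr.
have [+ +] := fl; rewrite /derivable /derive -slope_shift => cv dE.
have {}cv : (fun s => (s - 0)^-1 *: (f (x + s *: h) - f (x + 0 *: h))) @ 0^'+
    --> '[gradient f x, h].
  by apply: cvg_dnbhs_at_right; rewrite -dE.
apply: (cvgr_to_le cv); near=> s.
have s0 : 0 < s by near: s; exact: nbhs_right_gt.
have s1 : s <= 1 by near: s; exact: nbhs_right_le.
rewrite subr0 scale0r addr0.
have -> : s^-1 *: (f (x + s *: h) - f x) = (f (x + s *: h) - f x) / s by rewrite mulrC.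
rewrite ler_pdivrMr //.
have := fc (Itv01 (ltW s0) s1) y x.
rewrite /conv /= /conv /= !inE => /(_ I I).
have -> : s *: y + (1 - s) *: x = x + s *: h.
  by rewrite /h scalerBr scalerBl scale1r addrCA.
have -> : s *: f y + (1 - s) *: f x = s * f y + (1 - s) * f x by [].
lra.
Unshelve. all: by end_near. Qed.

Lemma descent_lemma (R : realType) (X : hilbertType R) (f : X -> R) (ell : R) (x y : X) :
  (forall z, differentiable f z) ->
  (forall u v, `|gradient f u - gradient f v| <= ell * `|u - v|) ->
  f y <= f x + '[gradient f x, y - x] + ell / 2 * `|y - x| ^+ 2.
Proof.
move=> df lip; set h := y - x.
pose F s := f (x + s *: h) - ('[gradient f x, h] * s + (ell / 2 * `|h| ^+ 2) * s ^+ 2).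
pose dF s := '[gradient f (x + s *: h), h] -
   ('[gradient f x, h] * 1 + (ell / 2 * `|h| ^+ 2) * (2 * s)).
have FF s : is_derive s (1 : R) F (dF s).
  have fl := @is_derive_gradient R X f (fun s => x + s *: h) s h (df _) (is_derive_line _ _ _).
  exact: (is_deriveB_pt fl (is_deriveD_pt (is_deriveMl_pt _ (is_derive_id_pt s))
    (is_deriveMl_pt _ (is_derive_sqr_pt s)))).
have : F 1 <= F 0.
  apply: (@is_derive_nonincreasing _ F dF 0 1 ler01 (fun t _ _ => FF t)) => t t0 _.
  rewrite /dF.
  have : '[gradient f (x + t *: h) - gradient f x, h] <= ell * t * `|h| * `|h|.
    apply: (le_trans (ler_norm _)); apply: (le_trans (CauchySchwarz_inner _ _)).
    rewrite ler_wpM2r //; apply: (le_trans (lip _ _)).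
    by rewrite addrAC subrr add0r normrZ ger0_norm // mulrA.
  have aux (p q r : R) : p - q <= ell * t * r * r ->
    p - (q * 1 + ell / 2 * r ^+ 2 * (2 * t)) <= 0 by lra.
  by rewrite innerBl; exact: aux.
rewrite /F scale0r scale1r addr0 {1}/h addrCA subrr addr0.
by move: (f y) (f x) '[gradient f x, h] `|h| => p q r n; lra.
Qed.

(* Baillon-Haddad type *)
(** Compare the tangent of f at x with the descent lemma at y, both evaluated at
    the gradient step z below. *)
Lemma convex_gradient_sqr_le (R : realType) (X : hilbertType R) (f : X -> R)
    (ell : R) (x y : X) :
  @convex_function R X setT f -> (forall z, differentiable f z) -> 0 < ell ->
  (forall u v, `|gradient f u - gradient f v| <= ell * `|u - v|) ->
  f x + '[gradient f x, y - x] + `|gradient f y - gradient f x| ^+ 2 / (2 * ell) <= f y.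
Proof.
move=> fc df ell0 lip.
set d := gradient f y - gradient f x.
pose z := y - ell^-1 *: d.
have h1 := convex_gradient_le z fc (df x).
have h2 := descent_lemma y z df lip.
have := le_trans h1 h2.
have -> : z - y = - (ell^-1 *: d) by rewrite /z addrAC subrr add0r.
have -> : z - x = (y - x) - ell^-1 *: d by rewrite /z addrAC.
rewrite normrN -!inner_normE /d.
move: (gradient f x) (gradient f y) (f x) (f y) (y - x) => g1 g2 p q w.
rewrite !(innerBl, innerBr, innerNr, innerZl, innerZr) (innerC g2 g1).
move: '[g1, w] '[g1, g1] '[g1, g2] '[g2, g2] => c1 c2 c3 c4.
rewrite -subr_ge0 => h; rewrite -subr_ge0; apply: (le_trans h).
by rewrite le_eqVlt; apply/orP; left; apply/eqP; field; rewrite gt_eqF.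
Qed.

(** A lower bound of the monotonicity pairing by the Bregman distance and the
    squared gradient difference: one term makes the Lyapunov function decrease,
    the other is the dissipation. *)
Lemma convex_gradient_cocoercive (R : realType) (X : hilbertType R) (f : X -> R)
    (ell : R) (x y : X) (d := gradient f y - gradient f x) :
  @convex_function R X setT f -> (forall z, differentiable f z) -> 0 < ell ->
  (forall u v, `|gradient f u - gradient f v| <= ell * `|u - v|) ->
  f y - f x - '[gradient f x, y - x] + '[d, d] / (2 * ell) <= '[d, y - x].
Proof.
have aux (u v a b c : R) : u - a + c <= v -> u - v - b + c <= a - b by lra.
move=> fc df ell0 lip; have h := convex_gradient_sqr_le y x fc df ell0 lip.
have e1 : '[gradient f y, x - y] = - '[gradient f y, y - x].
  by rewrite -(opprB y x) innerNr.
have e2 : `|gradient f x - gradient f y| ^+ 2 = '[d, d].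
  by rewrite -(opprB (gradient f y)) normrN inner_normE.
have e3 : '[d, y - x] = '[gradient f y, y - x] - '[gradient f x, y - x].
  exact: innerBl.
by rewrite e3; apply: aux; rewrite -e1 -e2.
Qed.

(** A nonzero residual could be used to improve: a step lams + (A xs - b)
    in the multiplier, or a gradient step of length 1 / ell in the primal
    variable. *)
Lemma saddle_point_KKT (R : realType) (X Y : hilbertType R) (f : X -> R)
    (A : {linear X -> Y}) (b : Y) (ell : R) (xs : X) (lams : Y) :
  (forall z, differentiable f z) -> continuous A -> 0 < ell ->
  (forall u v, `|gradient f u - gradient f v| <= ell * `|u - v|) ->
  saddle_points f A b (xs, lams) ->
  gradient f xs + adjoint A lams = 0 /\ A xs = b.
Proof.
move=> df Ac ell0 lip sp; split; last first.
  have [+ _] := sp xs (lams + (A xs - b)).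
  rewrite /lagrangian /= innerDl inner_normE => h.
  apply/eqP; rewrite -subr_eq0 -normr_eq0 -sqrf_eq0 eq_le sqr_ge0 andbT.
  by move: h; move: (f xs) '[lams, A xs - b] `|A xs - b| => p q r; lra.
set v := gradient f xs + adjoint A lams.
have [_] := sp (xs - ell^-1 *: v) lams.
rewrite /lagrangian /=.
have := descent_lemma xs (xs - ell^-1 *: v) df lip.
have -> : xs - ell^-1 *: v - xs = - (ell^-1 *: v) by rewrite addrAC subrr add0r.
have -> : A (xs - ell^-1 *: v) - b = (A xs - b) - ell^-1 *: A v.
  by rewrite linearB linearZ addrAC.
rewrite normrN -inner_normE innerNr !innerZr innerZl (innerBr (A xs - b) _ lams) innerZr.
have vv : '[gradient f xs, v] + '[lams, A v] = '[v, v].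
  by rewrite [X in _ + X]innerC adjointP // [X in _ + X]innerC -innerDl.
have : 0 <= '[v, v] by rewrite inner_normE sqr_ge0.
suff H : '[v, v] <= 0 -> v = 0.
  move: vv H; move: '[v, v] '[gradient f xs, v] '[lams, A v] '[lams, A xs - b] => c1 c2 c3 c4.
  move: (f _) (f _) => p q vv + c0 h1 h2; apply.
  rewrite -vv.
  have e0 : 0 < ell^-1 by rewrite invr_gt0.
  rewrite -(ler_pM2l e0) mulr0.
  have : ell / 2 * (ell^-1 * (ell^-1 * c1)) = ell^-1 * c1 / 2.
    by field; rewrite gt_eqF.
  rewrite -vv in h1 *; lra.
rewrite inner_normE => v0.
by apply/eqP; rewrite -normr_eq0 -sqrf_eq0 eq_le v0 sqr_ge0.
Qed.

(** * From dissipation to a pointwise rate *)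
Lemma is_derive_continuous (R : realType) (V : normedModType R) (u : R -> V) (t : R) (du : V) :
  is_derive t 1 u du -> u s @[s --> t] --> u t.
Proof.
by case=> /derivable1_diffP h _; exact: differentiable_continuous.
Qed.

Lemma is_derive_slope_right (R : realType) (V : normedModType R) (u : R -> V) (t : R) (du : V) :
  is_derive t 1 u du -> (s - t)^-1 *: (u s - u t) @[s --> t^'+] --> du.
Proof.
case; rewrite /derivable /derive -slope_shift => cv dE.
by apply: cvg_dnbhs_at_right; rewrite -dE.
Qed.

(** V is a Lyapunov function, bounded below, that dissipates
    t delta |q|^2 + t |z'|^2.  The curve q is a Lipschitz function of z rather
    than a differentiable curve, because grad f is only Lipschitz. *)
Section DissipationRate.
Context {R : realType} {X Z : normedModType R}.
Variables (delta ddelta V dV : R -> R) (q : R -> X) (z dz : R -> Z).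
Variables (t1 d0 kappa c L M : R).
Hypothesis t1_gt0 : 0 < t1.
Hypothesis d0_gt0 : 0 < d0.
Hypothesis kappa_ge0 : 0 <= kappa.
Hypothesis c_gt0 : 0 < c.
Hypothesis L_ge0 : 0 <= L.
Hypothesis delta_derive : forall t, t1 <= t -> is_derive t 1 delta (ddelta t).
Hypothesis delta_ge : forall t, t1 <= t -> d0 <= delta t.
Hypothesis delta_growth : forall t, t1 <= t -> t * ddelta t <= kappa * delta t.
Hypothesis z_derive : forall t, t1 <= t -> is_derive t 1 z (dz t).
Hypothesis q_lipschitz : forall s t, `|q s - q t| <= L * `|z s - z t|.
Hypothesis V_derive : forall t, t1 <= t -> is_derive t 1 V (dV t).
Hypothesis V_dissipation : forall t, t1 <= t ->
  dV t <= - (c * (t * delta t * `|q t| ^+ 2 + t * `|dz t| ^+ 2)).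
Hypothesis V_ge : forall t, t1 <= t -> - M <= V t.

Let w t := t * Num.sqrt (delta t).
Let phi t := w t * `|q t| ^+ 2.

Let delta_gt0 t : t1 <= t -> 0 < delta t.
Proof. by move=> ht; exact: lt_le_trans (delta_ge ht). Qed.

Let t_gt0 t : t1 <= t -> 0 < t.
Proof. exact: lt_le_trans. Qed.

Let sqrt_delta_gt0 t : t1 <= t -> 0 < Num.sqrt (delta t).
Proof. by move=> ht; rewrite sqrtr_gt0 delta_gt0. Qed.

Let dw t := Num.sqrt (delta t) + t * (ddelta t / (2 * Num.sqrt (delta t))).

Let w_derive t : t1 <= t -> is_derive t 1 w (dw t).
Proof.
move=> ht; have sd := is_derive1_sqrt (delta_gt0 ht).
have sdd := is_derive1_comp sd (delta_derive ht).
apply: is_derive_eq (is_deriveM_pt (is_derive_id_pt t) sdd) _.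
by rewrite /dw mul1r /= [(_)^-1 * _]mulrC.
Qed.

Let C1 := (1 + kappa / 2) / (t1 * Num.sqrt d0).

Let dw_le t : t1 <= t -> dw t <= C1 * (t * delta t).
Proof.
move=> ht; have s0 := sqrt_delta_gt0 ht; have d := delta_gt0 ht; have t0 := t_gt0 ht.
have sd0 : 0 < Num.sqrt d0 by rewrite sqrtr_gt0.
have sle : Num.sqrt d0 <= Num.sqrt (delta t) by exact/ler_wsqrtr/delta_ge.
have k0 : 0 <= 1 + kappa / 2 by rewrite addr_ge0 // divr_ge0.
have dE : delta t = Num.sqrt (delta t) ^+ 2 by rewrite sqr_sqrtr // ltW.
have h1 : dw t <= (1 + kappa / 2) * Num.sqrt (delta t).
  rewrite /dw [X in _ <= X]mulrDl mul1r lerD2l mulrA ler_pdivrMr ?mulr_gt0 //.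
  rewrite (le_trans (delta_growth ht)) // {1}dE le_eqVlt; apply/orP; left.
  by apply/eqP; field.
have h2 : t1 * Num.sqrt d0 <= t * Num.sqrt (delta t) by rewrite ler_pM // ltW.
have -> : t * delta t = t * Num.sqrt (delta t) * Num.sqrt (delta t).
  by rewrite {1}dE expr2 mulrA.
apply: (le_trans h1); rewrite /C1 -mulrA ler_wpM2l // ler_pdivlMl ?mulr_gt0 //.
by rewrite ler_wpM2r // ltW.
Qed.

Let C1_ge0 : 0 <= C1.
Proof.
apply: divr_ge0; first by apply: addr_ge0 => //; exact: divr_ge0.
by apply: mulr_ge0; [exact: ltW | exact: sqrtr_ge0].
Qed.

Let C := (C1 + L) / c.

Let C_ge0 : 0 <= C.
Proof. by apply: divr_ge0; [exact: addr_ge0 | exact: ltW]. Qed.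

Let q_cvg t : t1 <= t -> q s @[s --> t] --> q t.
Proof.
move=> ht; apply/cvgrPdist_le => e e0.
have L1 : 0 < L + 1 by rewrite ltr_wpDl.
have e1 : 0 < e / (L + 1) by rewrite divr_gt0.
have /cvgrPdist_le /(_ _ e1) H := is_derive_continuous (z_derive ht).
near=> s; apply: (le_trans (q_lipschitz _ _)).
have hs : `|z t - z s| <= e / (L + 1) by near: s.
rewrite ler_pdivlMr // in hs; apply: le_trans hs.
by rewrite mulrC ler_wpM2l // lerDl.
Unshelve. all: by end_near. Qed.

(** The left-hand side bounds the limit of the right difference quotients of
    F = phi + C V.  It is nonpositive by Young's inequality in the form
    2 sqrt(delta) |q| |z'| <= delta |q|^2 + |z'|^2; the constant C is chosen for
    this. *)
Let slope_limit_le0 t : t1 <= t ->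
  dw t * `|q t| ^+ 2 + w t * (L * `|dz t|) * (`|q t| + `|q t|) + C * dV t <= 0.
Proof.
move=> ht.
have h1 : dw t * `|q t| ^+ 2 <= C1 * (t * delta t * `|q t| ^+ 2).
  by rewrite (mulrA C1); apply: ler_wpM2r; [exact: sqr_ge0 | exact: dw_le].
have h2 : w t * (L * `|dz t|) * (`|q t| + `|q t|) <=
    L * (t * delta t * `|q t| ^+ 2 + t * `|dz t| ^+ 2).
  have -> : w t * (L * `|dz t|) * (`|q t| + `|q t|) =
     L * (t * (2 * (Num.sqrt (delta t) * `|q t|) * `|dz t|)) by rewrite /w; ring.
  have -> : t * delta t * `|q t| ^+ 2 + t * `|dz t| ^+ 2 =
     t * ((Num.sqrt (delta t) * `|q t|) ^+ 2 + `|dz t| ^+ 2).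
    by rewrite exprMn sqr_sqrtr ?(ltW (delta_gt0 _)) //; ring.
  apply: ler_wpM2l => //; apply: ler_wpM2l; first exact/ltW/t_gt0.
  by have := sqr_ge0 (Num.sqrt (delta t) * `|q t| - `|dz t|); lra.
have h3 : C * dV t <= - ((C1 + L) * (t * delta t * `|q t| ^+ 2 + t * `|dz t| ^+ 2)).
  apply: (le_trans (ler_wpM2l C_ge0 (V_dissipation ht))).
  by rewrite mulrN mulrA divfK // gt_eqF.
have h4 : 0 <= C1 * (t * `|dz t| ^+ 2).
  apply: mulr_ge0 => //; apply: mulr_ge0; last exact: sqr_ge0.
  exact/ltW/t_gt0.
lra.
Qed.

Let F t := phi t + C * V t.

Let F_nonincreasing a b : t1 <= a -> a <= b -> F b <= F a.
Proof.
move=> ha ab; apply: dini_nonincreasing => // [t ta _|t ta _ e e0].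
  have ht := le_trans ha ta.
  apply: cvgD; last first.
    by apply: cvgM; [exact: cvg_cst | exact: is_derive_continuous (V_derive ht)].
  apply: cvgM; first exact: is_derive_continuous (w_derive ht).
  rewrite expr2; under eq_fun do rewrite expr2.
  by apply: cvgM; apply: cvg_norm; exact: q_cvg.
have ht := le_trans ha ta.
(* Phi dominates the difference quotient of F and has a limit at t. *)
pose Phi s := ((s - t)^-1 *: (w s - w t)) * `|q s| ^+ 2 +
  w t * (L * `|(s - t)^-1 *: (z s - z t)|) * (`|q s| + `|q t|) +
  C * ((s - t)^-1 *: (V s - V t)).
have qr : `|q s| @[s --> t^'+] --> `|q t|.
  by apply: cvg_norm; apply: cvg_at_right_filter; exact: q_cvg.
have cPhi : Phi s @[s --> t^'+] --> dw t * `|q t| ^+ 2 +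
  w t * (L * `|dz t|) * (`|q t| + `|q t|) + C * dV t.
  apply: cvgD; last first.
    by apply: cvgM; [exact: cvg_cst | exact: is_derive_slope_right (V_derive ht)].
  apply: cvgD.
    apply: cvgM; first exact: is_derive_slope_right (w_derive ht).
    rewrite expr2; under eq_fun do rewrite expr2.
    by apply: cvgM.
  apply: cvgM; last by apply: cvgD => //; exact: cvg_cst.
  apply: cvgM; first exact: cvg_cst.
  apply: cvgM; first exact: cvg_cst.
  by apply: cvg_norm; exact: is_derive_slope_right (z_derive ht).
have He : \forall s \near t^'+, Phi s <= e.
  by apply: (cvgr_le _ cPhi); exact: le_lt_trans (slope_limit_le0 ht) e0.
near=> s.
have st : 0 < s - t by rewrite subr_gt0; near: s; exact: nbhs_right_gt.
have : Phi s <= e by near: s.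
rewrite -(ler_pM2r st); apply: le_trans.
have w0 : 0 <= w t by rewrite mulr_ge0 ?sqrtr_ge0 // ltW // t_gt0.
have qq : `|q s| - `|q t| <= L * `|z s - z t|.
  by apply: le_trans (q_lipschitz _ _); exact: lerB_dist.
rewrite /Phi normrZ gtr0_norm ?invr_gt0 //.
have -> : ((s - t)^-1 *: (w s - w t) * `|q s| ^+ 2 +
    w t * (L * ((s - t)^-1 * `|z s - z t|)) * (`|q s| + `|q t|) +
    C * ((s - t)^-1 *: (V s - V t))) * (s - t) =
  (w s - w t) * `|q s| ^+ 2 + w t * ((L * `|z s - z t|) * (`|q s| + `|q t|)) +
    C * (V s - V t).
  have sc (x : R) : (s - t)^-1 *: x = (s - t)^-1 * x by [].
  by rewrite !sc; field; rewrite gt_eqF.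
have h := ler_wpM2l w0 (ler_wpM2r (addr_ge0 (normr_ge0 (q s)) (normr_ge0 (q t))) qq).
rewrite /F /phi; lra.
Unshelve. all: by end_near. Qed.

Let V_nonincreasing a b : t1 <= a -> a <= b -> V b <= V a.
Proof.
move=> ha ab; apply: (@is_derive_nonincreasing _ V dV) => // [t ta _|t ta _].
  exact/V_derive/(le_trans ha ta).
have ht := le_trans ha ta; apply: (le_trans (V_dissipation ht)).
have t0 := ltW (t_gt0 ht); have d := ltW (delta_gt0 ht).
rewrite oppr_le0; apply: mulr_ge0; first exact: ltW.
by apply: addr_ge0; apply: mulr_ge0; rewrite ?sqr_ge0 //; exact: mulr_ge0.
Qed.

(** If phi stayed above e / 2, V would decrease linearly, against its lower
    bound.  So phi <= e / 2 at a time s after which V decreases by little, and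
    monotonicity of F propagates the bound to all later times. *)
Lemma dissipation_rate e : 0 < e ->
  exists2 T, t1 <= T & forall t, T <= t -> t * Num.sqrt (delta t) * `|q t| ^+ 2 <= e.
Proof.
move=> e0.
pose S := [set V t | t in [set t | t1 <= t]].
have hS : has_inf S.
  split; first by exists (V t1); exists t1 => //=.
  by exists (- M) => _ [t ht <-]; exact: V_ge.
have C1p : 0 < 2 * (C + 1) by rewrite mulr_gt0 // ltr_wpDl.
have e1 : 0 < e / (2 * (C + 1)) by rewrite divr_gt0.
have [_ [T0 /= hT0 <-] VT0] := inf_adherent e1 hS.
have [s [Ts phis]] : exists s, T0 <= s /\ phi s <= e / 2.
  apply: contrapT => H.
  have big s : T0 <= s -> e / 2 < phi s.
    by move=> Ts; rewrite ltNge; apply/negP => ph; apply: H; exists s.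
  pose eta := c * (Num.sqrt d0 * (e / 2)).
  have eta0 : 0 < eta by rewrite !mulr_gt0 // sqrtr_gt0.
  have dVle s : T0 <= s -> dV s + eta * 1 <= 0.
    move=> Ts; have ht := le_trans hT0 Ts.
    rewrite mulr1 addrC -lerBrDr sub0r.
    rewrite lerNr; apply: (le_trans (V_dissipation ht)); rewrite lerN2.
    rewrite /eta; apply: ler_wpM2l; first exact: ltW.
    rewrite -[X in X <= _]addr0; apply: lerD; last first.
      by apply: mulr_ge0; [exact/ltW/t_gt0 | exact: sqr_ge0].
    have -> : s * delta s * `|q s| ^+ 2 = Num.sqrt (delta s) * phi s.
      rewrite /phi /w -{1}(sqr_sqrtr (ltW (delta_gt0 ht))); ring.
    apply: ler_pM; rewrite ?sqrtr_ge0 ?divr_ge0 ?(ltW e0) ?(ltW (big _ Ts)) //.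
    exact/ler_wsqrtr/delta_ge.
  (* the time at which a decrease of slope eta has pushed V below - M *)
  pose T2 := T0 + (V T0 + M + 1) / eta.
  have VM : 0 <= V T0 + M + 1 by have := V_ge hT0; lra.
  have TT : T0 <= T2 by rewrite lerDl; apply: divr_ge0 => //; exact: ltW.
  have : V T2 + eta * T2 <= V T0 + eta * T0.
    apply: (@is_derive_nonincreasing _ (fun s => V s + eta * s)
      (fun s => dV s + eta * 1)) => // s Ts _.
      exact: (is_deriveD_pt (V_derive (le_trans hT0 Ts))
        (is_deriveMl_pt eta (is_derive_id_pt s))).
    exact: dVle.
  have := V_ge (le_trans hT0 TT).
  rewrite {3}/T2 mulrDr mulrCA divff ?gt_eqF //; lra.
have hs := le_trans hT0 Ts.
exists s => // t st.
have ht := le_trans hs st.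
have := F_nonincreasing hs st; rewrite /F -/(phi t) => hF.
have Vs := V_nonincreasing hT0 Ts.
have Vt : inf S <= V t by apply: ge_inf; [case: hS | exists t].
have : C * (V s - V t) <= e / 2.
  apply: (@le_trans _ _ ((C + 1) * (e / (2 * (C + 1))))).
    apply: ler_pM => //; first by rewrite subr_ge0 V_nonincreasing.
      by rewrite lerDl.
    lra.
  by rewrite le_eqVlt; apply/orP; left; apply/eqP; field; lra.
rewrite -/(w t) -/(phi t); lra.
Qed.

End DissipationRate.

(** * The Lyapunov analysis of the dynamics *)
Lemma is_derive_linear (R : realType) (V W : normedModType R) (A : {linear V -> W})
    (u : R -> V) (t : R) (du : V) :
  continuous A -> is_derive t 1 u du -> is_derive t 1 (fun s => A (u s)) (A du).
Proof.
move=> Ac [hu eu].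
have du' : differentiable u t by apply/derivable1_diffP.
have dA : differentiable A (u t) by exact: linear_differentiable.
have dc : differentiable (A \o u) t by apply: differentiable_comp.
split; first exact: diff_derivable dc.
have -> : (fun s => A (u s)) = A \o u by [].
by rewrite deriveE // diff_comp //= -(deriveE _ du') eu diff_lin.
Qed.

(** Only the values of F above c are controlled, so monotonicity is applied to
    the maximum of F and c. *)
Lemma is_derive_barrier (R : realType) (F dF : R -> R) (c a b : R) : a <= b ->
  (forall t, a <= t -> t <= b -> is_derive t 1 F (dF t)) ->
  (forall t, a <= t -> t <= b -> c <= F t -> dF t <= 0) ->
  F a <= c -> F b <= c.
Proof.
move=> ab Fd dF0 Fa.
have maxE t : c <= F t -> Num.max (F t) c = F t by move/max_idPl.
have maxE' t : F t <= c -> Num.max (F t) c = c by move/max_idPr.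
suff : Num.max (F b) c <= Num.max (F a) c.
  by rewrite (maxE' a) // ge_max => /andP [].
apply: (@dini_nonincreasing _ (fun s => Num.max (F s) c)) => // [t ta tb|t ta tb e e0].
  have Fc := is_derive_continuous (Fd t ta tb).
  by apply: (@continuous_max _ _ F (cst c)) => //; exact: cvg_cst.
have [cF|Fc] := leP c (F t).
  have H := is_derive_right_le (Fd t ta (ltW tb)) e0.
  near=> s.
  have st : 0 <= s - t by rewrite subr_ge0 ltW//; near: s; exact: nbhs_right_gt.
  have Hs : F s - F t <= (dF t + e) * (s - t) by near: s.
  have h : F s - F t <= e * (s - t).
    by apply: (le_trans Hs); rewrite ler_wpM2r // gerDr dF0 // ltW.
  have h0 : 0 <= e * (s - t) by rewrite mulr_ge0 // ltW.
  rewrite lerBlDr ge_max; apply/andP; split; lra.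
have Fl : \forall s \near t^'+, F s <= c.
  have Fcont := is_derive_continuous (Fd t ta (ltW tb)).
  have Fr : F s @[s --> t^'+] --> F t by exact: cvg_at_right_filter.
  exact: (cvgr_le _ Fr).
near=> s.
have st : 0 <= s - t by rewrite subr_ge0 ltW//; near: s; exact: nbhs_right_gt.
have -> : Num.max (F s) c = c by apply: maxE'; near: s.
by rewrite subrr mulr_ge0 // ltW.
Unshelve. all: by end_near. Qed.

(** The system seen from a saddle point: p and r are the displacements of x
    and lam from it, dx and dl the velocities, As the adjoint of A, g the gradient
    difference and D the Bregman distance of f from xs to x. *)
Section PrimalDualEnergy.
Context {R : realType} {X Y : hilbertType R}.
Variables (A : {linear X -> Y}) (As : {linear Y -> X}).
Variables (alpha theta beta ell t1 d0 K : R).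
Variables (delta ddelta D : R -> R).
Variables (p dx ddx g : R -> X) (r dl ddl : R -> Y).
Hypothesis A_continuous : continuous A.
Hypothesis As_continuous : continuous As.
Hypothesis adjE : forall u y, '[u, As y] = '[A u, y].
Hypothesis K_ge0 : 0 <= K.
Hypothesis A_le : forall u, `|A u| <= K * `|u|.
Hypothesis As_le : forall y, `|As y| <= K * `|y|.
Hypothesis ell_gt0 : 0 < ell.
Hypothesis beta_ge0 : 0 <= beta.
Hypothesis theta_gt0 : 0 < theta.
Hypothesis theta_lt : theta < 2^-1.
Hypothesis xi_gt0 : 0 < alpha * theta - theta - 1.
Hypothesis t1_ge1 : 1 <= t1.
Hypothesis d0_gt0 : 0 < d0.
Hypothesis delta_ge : forall t, t1 <= t -> d0 <= delta t.
Hypothesis delta_derive : forall t, t1 <= t -> is_derive t 1 delta (ddelta t).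
Hypothesis delta_growth : forall t, t1 <= t ->
  theta * (t * ddelta t) <= (1 - 2 * theta) * delta t.
Hypothesis p_derive : forall t, t1 <= t -> is_derive t 1 p (dx t).
Hypothesis dx_derive : forall t, t1 <= t -> is_derive t 1 dx (ddx t).
Hypothesis r_derive : forall t, t1 <= t -> is_derive t 1 r (dl t).
Hypothesis dl_derive : forall t, t1 <= t -> is_derive t 1 dl (ddl t).
Hypothesis D_derive : forall t, t1 <= t -> is_derive t 1 D '[g t, dx t].
Hypothesis D_ge0 : forall t, 0 <= D t.
Hypothesis cocoercive : forall t, D t + '[g t, g t] / (2 * ell) <= '[g t, p t].
Hypothesis g_lipschitz : forall s t, `|g s - g t| <= ell * `|p s - p t|.
Hypothesis ddxE : forall t, t1 <= t -> ddx t = - ((alpha / t) *: dx t) -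
  delta t *: (g t + As (r t + (theta * t) *: dl t) + beta *: As (A (p t))).
Hypothesis ddlE : forall t, t1 <= t -> ddl t = - ((alpha / t) *: dl t) +
  delta t *: A (p t + (theta * t) *: dx t).

Let t_gt0 t : t1 <= t -> 0 < t.
Proof. by move=> ht; apply: lt_le_trans ht; exact: lt_le_trans t1_ge1. Qed.

Let delta_gt0 t : t1 <= t -> 0 < delta t.
Proof. by move=> ht; exact: lt_le_trans (delta_ge ht). Qed.

Let Ap t := A (p t).
Let Adx t := A (dx t).
Let xi := alpha * theta - theta - 1.

Let inner_ddx u t : t1 <= t -> '[u, ddx t] = - (alpha / t * '[u, dx t]) -
  delta t * ('[u, g t] + ('[A u, r t] + theta * t * '[A u, dl t])
   + beta * '[A u, Ap t]).
Proof.
move=> ht; rewrite ddxE // innerBr innerNr !innerZr !innerDr !adjE innerZr.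
by rewrite innerDr innerZr adjE.
Qed.

Let inner_ddl y t : t1 <= t -> '[y, ddl t] = - (alpha / t * '[y, dl t]) +
  delta t * ('[y, Ap t] + theta * t * '[y, Adx t]).
Proof.
move=> ht; rewrite ddlE //.
have -> : A (p t + (theta * t) *: dx t) = Ap t + (theta * t) *: Adx t.
  by rewrite linearD linearZ.
by rewrite innerDr innerNr !innerZr innerDr innerZr.
Qed.

Let Ap_derive t : t1 <= t -> is_derive t 1 Ap (Adx t).
Proof. by move=> ht; apply: is_derive_linear => //; exact: p_derive. Qed.

(** The Lyapunov function, with its squares expanded so that it is an expression
    in scalar products. *)
Let E t := theta ^+ 2 * (t ^+ 2 * (delta t * (D t + beta / 2 * '[Ap t, Ap t])))
  + (1 + xi) / 2 * ('[p t, p t] + '[r t, r t])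
  + theta * (t * ('[p t, dx t] + '[r t, dl t]))
  + theta ^+ 2 / 2 * (t ^+ 2 * ('[dx t, dx t] + '[dl t, dl t])).

Let dE t := theta * (2 * theta * (t * delta t) + theta * (t ^+ 2 * ddelta t)) *
    (D t + beta / 2 * '[Ap t, Ap t])
  - theta * (t * delta t) * ('[g t, p t] + beta * '[Ap t, Ap t])
  - xi * theta * (t * ('[dx t, dx t] + '[dl t, dl t])).

(** The coefficient of '[p, dx] + '[r, dl] is 1 + xi + theta - theta alpha = 0,
    and the coupling terms in A cancel because the two equations are
    evaluated at extrapolated points with the same theta. *)
Let E_derive t : t1 <= t -> is_derive t 1 E (dE t).
Proof.
move=> ht.
have ap := is_derive_inner (Ap_derive ht) (Ap_derive ht).
have pp := is_derive_inner (p_derive ht) (p_derive ht).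
have rr := is_derive_inner (r_derive ht) (r_derive ht).
have px := is_derive_inner (p_derive ht) (dx_derive ht).
have rl := is_derive_inner (r_derive ht) (dl_derive ht).
have xx := is_derive_inner (dx_derive ht) (dx_derive ht).
have ll := is_derive_inner (dl_derive ht) (dl_derive ht).
have sq := is_derive_sqr_pt t.
have d1 := is_deriveMl_pt (theta ^+ 2) (is_deriveM_pt sq
  (is_deriveM_pt (delta_derive ht)
     (is_deriveD_pt (D_derive ht) (is_deriveMl_pt (beta / 2) ap)))).
have d2 := is_deriveMl_pt ((1 + xi) / 2) (is_deriveD_pt pp rr).
have d3 := is_deriveMl_pt theta (is_deriveM_pt (is_derive_id_pt t) (is_deriveD_pt px rl)).
have d4 := is_deriveMl_pt (theta ^+ 2 / 2) (is_deriveM_pt sq (is_deriveD_pt xx ll)).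
apply: is_derive_eq (is_deriveD_pt (is_deriveD_pt (is_deriveD_pt d1 d2) d3) d4) _.
rewrite (innerC (ddx t)) (innerC (ddl t)) !(inner_ddx _ ht) !(inner_ddl _ ht).
rewrite -/(Ap t) -/(Adx t) /dE /xi.
rewrite (innerC (dx t) (p t)) (innerC (dl t) (r t)) (innerC (Adx t) (Ap t)).
rewrite (innerC (p t) (g t)) (innerC (dx t) (g t)).
rewrite (innerC (r t) (Ap t)) (innerC (r t) (Adx t)) (innerC (dl t) (Ap t)).
rewrite (innerC (dl t) (Adx t)).
have t0 : t != 0 by rewrite gt_eqF // t_gt0.
move: '[p t, p t] '[p t, dx t] '[dx t, dx t] '[r t, r t] '[r t, dl t] '[dl t, dl t].
move: '[Ap t, Ap t] '[Ap t, Adx t] '[g t, p t] '[g t, dx t].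
move: '[Ap t, r t] '[Ap t, dl t] '[Adx t, r t] '[Adx t, dl t] (D t) (delta t) (ddelta t).
by move=> *; field.
Qed.

Let G_ge0 t : 0 <= D t + beta / 2 * '[Ap t, Ap t].
Proof. by rewrite addr_ge0 // mulr_ge0 ?divr_ge0 // inner_ge0. Qed.

Let dE_le t : t1 <= t -> dE t <=
  - (theta / (2 * ell) * (t * delta t * '[g t, g t]) +
     xi * theta * (t * ('[dx t, dx t] + '[dl t, dl t]))).
Proof.
move=> ht; have t0 := t_gt0 ht.
have G0 := G_ge0 t.
have aa : 0 <= beta * '[Ap t, Ap t] by rewrite mulr_ge0 // inner_ge0.
have h1 : (2 * theta * (t * delta t) + theta * (t ^+ 2 * ddelta t)) *
   (D t + beta / 2 * '[Ap t, Ap t]) <= t * delta t * (D t + beta / 2 * '[Ap t, Ap t]).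
  apply: ler_wpM2r => //.
  have := ler_wpM2l (ltW t0) (delta_growth ht); rewrite expr2; lra.
have h2 : t * delta t * (D t + beta / 2 * '[Ap t, Ap t] + '[g t, g t] / (2 * ell)) <=
   t * delta t * ('[g t, p t] + beta * '[Ap t, Ap t]).
  apply: ler_wpM2l; first by rewrite mulr_ge0 ?ltW // delta_gt0.
  have := cocoercive t; move: aa; move: '[Ap t, Ap t] '[g t, g t] '[g t, p t] => a b c.
  lra.
rewrite /dE.
have := ler_wpM2l (ltW theta_gt0) (lerD h1 h2).
move: '[Ap t, Ap t] '[g t, p t] (D t) (xi * theta * _) => a b d z.
have -> : theta / (2 * ell) * (t * delta t * '[g t, g t]) =
   theta * (t * delta t * ('[g t, g t] / (2 * ell))) by field; rewrite gt_eqF.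
move: ('[g t, g t] / (2 * ell)) => c; move: (delta t) (ddelta t) => e f; lra.
Qed.

Let E_le t : t1 <= t -> E t <= E t1.
Proof.
move=> ht; apply: (is_derive_nonincreasing ht (fun s hs _ => E_derive hs)) => s hs _.
apply: (le_trans (dE_le hs)); rewrite oppr_le0.
have s0 := ltW (t_gt0 hs); have d := ltW (delta_gt0 hs).
have te := ltW theta_gt0.
apply: addr_ge0; apply: mulr_ge0.
- by apply: divr_ge0 => //; apply: mulr_ge0 => //; exact: ltW.
- by apply: mulr_ge0; [exact: mulr_ge0 | exact: inner_ge0].
- by apply: mulr_ge0 => //; exact: ltW.
- by apply: mulr_ge0 => //; apply: addr_ge0; exact: inner_ge0.
Qed.

Let E_potential_ge0 t : t1 <= t ->
  0 <= theta ^+ 2 * (t ^+ 2 * (delta t * (D t + beta / 2 * '[Ap t, Ap t]))).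
Proof.
move=> ht; apply: mulr_ge0; first exact: sqr_ge0.
apply: mulr_ge0; first exact: sqr_ge0.
by apply: mulr_ge0 => //; exact/ltW/delta_gt0.
Qed.

Let E_ge t : t1 <= t -> xi / 2 * ('[p t, p t] + '[r t, r t]) <= E t.
Proof.
move=> ht.
have h1 := E_potential_ge0 ht.
have := inner_lincomb_ge0 (p t) (dx t) 1 (theta * t).
have := inner_lincomb_ge0 (r t) (dl t) 1 (theta * t).
move: h1; rewrite /E; move: (theta ^+ 2 * (t ^+ 2 * (_ * _))) => G.
move: '[p t, p t] '[p t, dx t] '[dx t, dx t] '[r t, r t] '[r t, dl t] '[dl t, dl t].
move: xi => x *; lra.
Qed.

Let E1_ge0 : 0 <= E t1.
Proof.
apply: le_trans (E_ge (lexx _)); apply: mulr_ge0; first by rewrite divr_ge0 // ltW.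
by rewrite addr_ge0.
Qed.

Let B0 := 2 * E t1 / xi + (4 * E t1 + 4 * E t1 / xi) / theta ^+ 2.

(** Recovers the velocity part from |u|^2 and |u + a v|^2, as
    a v = (u + a v) - u. *)
Let E_velocity (Z : hilbertType R) (u v : Z) (a e : R) :
  xi / 2 * '[u, u] <= e ->
  '[u, u] + 2 * a * '[u, v] + a ^+ 2 * '[v, v] <= 2 * e ->
  a ^+ 2 * '[v, v] <= 4 * e + 4 * e / xi.
Proof.
move=> h1 h2; have := inner_lincomb_ge0 u v 2 a.
have h3 : '[u, u] <= 2 * e / xi by rewrite ler_pdivlMr //; move: '[u, u] h1 => c; lra.
have -> : 4 * e / xi = 2 * (2 * e / xi) by ring.
move: (2 * e / xi) h3 h2 => f; move: '[u, u] '[u, v] '[v, v] => c d b; lra.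
Qed.

Let trajectory_bounded t : t1 <= t ->
  [/\ '[p t, p t] <= B0, '[r t, r t] <= B0,
      t ^+ 2 * '[dx t, dx t] <= B0 & t ^+ 2 * '[dl t, dl t] <= B0].
Proof.
move=> ht; have Ele := E_le ht; have Ege := E_ge ht.
have e1 := E1_ge0.
have h1 := E_potential_ge0 ht.
have sp := inner_lincomb_ge0 (p t) (dx t) 1 (theta * t).
have sr := inner_lincomb_ge0 (r t) (dl t) 1 (theta * t).
have pp := inner_ge0 (p t); have rr := inner_ge0 (r t).
have xp : 0 <= xi / 2 * '[p t, p t] by rewrite mulr_ge0 // divr_ge0 // ltW.
have xr : 0 <= xi / 2 * '[r t, r t] by rewrite mulr_ge0 // divr_ge0 // ltW.
have c1 : xi / 2 * '[p t, p t] <= E t1.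
  move: Ele Ege xr; move: (E t) (E t1) '[p t, p t] '[r t, r t] => a b c e; lra.
have c2 : xi / 2 * '[r t, r t] <= E t1.
  move: Ele Ege xp; move: (E t) (E t1) '[p t, p t] '[r t, r t] => a b c e; lra.
have c3 : '[p t, p t] + 2 * (theta * t) * '[p t, dx t] +
    (theta * t) ^+ 2 * '[dx t, dx t] <= 2 * E t1.
  move: Ele h1 sp sr xp xr; move: (E t1) => b; rewrite /E.
  move: (theta ^+ 2 * (t ^+ 2 * (_ * _))) => G.
  move: '[p t, p t] '[p t, dx t] '[dx t, dx t] '[r t, r t] '[r t, dl t] '[dl t, dl t].
  move: xi => x *; lra.
have c4 : '[r t, r t] + 2 * (theta * t) * '[r t, dl t] +
    (theta * t) ^+ 2 * '[dl t, dl t] <= 2 * E t1.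
  move: Ele h1 sp sr xp xr; move: (E t1) => b; rewrite /E.
  move: (theta ^+ 2 * (t ^+ 2 * (_ * _))) => G.
  move: '[p t, p t] '[p t, dx t] '[dx t, dx t] '[r t, r t] '[r t, dl t] '[dl t, dl t].
  move: xi => x *; lra.
have t2 : 0 < theta ^+ 2 by rewrite exprn_gt0.
have b1 : 0 <= 2 * E t1 / xi by rewrite divr_ge0 ?mulr_ge0 // ltW.
have b2 : 0 <= (4 * E t1 + 4 * E t1 / xi) / theta ^+ 2.
  by rewrite divr_ge0 ?addr_ge0 ?divr_ge0 ?mulr_ge0 ?sqr_ge0 // ltW.
have k1 c : xi / 2 * c <= E t1 -> c <= B0.
  move=> h; apply: (@le_trans _ _ (2 * E t1 / xi)); last by rewrite lerDl.
  by rewrite ler_pdivlMr //; lra.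
have k2 c : (theta * t) ^+ 2 * c <= 4 * E t1 + 4 * E t1 / xi -> t ^+ 2 * c <= B0.
  move=> h; apply: (@le_trans _ _ ((4 * E t1 + 4 * E t1 / xi) / theta ^+ 2)).
    by rewrite ler_pdivlMr // mulrC mulrA -exprMn.
  by rewrite lerDr.
split; [exact: k1 | exact: k1 | apply: k2 | apply: k2].
  exact: (E_velocity c1 c3).
exact: (E_velocity c2 c4).
Qed.

Let alpha_gt1 : 0 < alpha - 1.
Proof.
have h : 0 < theta * (alpha - 1) by have := xi_gt0; lra.
by rewrite pmulr_rgt0 in h.
Qed.

Let M0 := (2 + 2 * (alpha - 1) ^+ 2) * B0.

(** The squared norm of the vector m = t dl + (alpha - 1) r (see multiplierE). *)
Let m_sqr t := t ^+ 2 * '[dl t, dl t] + 2 * (alpha - 1) * t * '[r t, dl t] +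
  (alpha - 1) ^+ 2 * '[r t, r t].

Let multiplier_le t : t1 <= t -> m_sqr t <= M0.
Proof.
move=> ht; have [_ h1 _ h2] := trajectory_bounded ht.
have := inner_lincomb_ge0 (r t) (dl t) (alpha - 1) (- t).
have := ler_wpM2l (sqr_ge0 (alpha - 1)) h1.
rewrite /M0 /m_sqr; move: h1 h2; move: '[r t, r t] '[r t, dl t] '[dl t, dl t] B0 => a b c d.
lra.
Qed.

Let Ap_m t := t * '[Ap t, dl t] + (alpha - 1) * '[Ap t, r t].

(** The squared norm of w = theta t^2 delta A p - m. *)
Let psi t := (theta * (t ^+ 2 * delta t)) ^+ 2 * '[Ap t, Ap t]
  - 2 * ((theta * (t ^+ 2 * delta t)) * Ap_m t) + m_sqr t.

Let dpsi t := - 2 * (((1 - 2 * theta) * (t * delta t) - theta * (t ^+ 2 * ddelta t)) *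
  (theta * (t ^+ 2 * delta t) * '[Ap t, Ap t] - Ap_m t)).

(** This is 2 '[w, w'] with w' = - k A p, where k is t times the slack of the growth
    bound on delta. *)
Let psi_derive t : t1 <= t -> is_derive t 1 psi (dpsi t).
Proof.
move=> ht.
have ap := is_derive_inner (Ap_derive ht) (Ap_derive ht).
have al := is_derive_inner (Ap_derive ht) (dl_derive ht).
have ar := is_derive_inner (Ap_derive ht) (r_derive ht).
have rr := is_derive_inner (r_derive ht) (r_derive ht).
have rl := is_derive_inner (r_derive ht) (dl_derive ht).
have ll := is_derive_inner (dl_derive ht) (dl_derive ht).
have sq := is_derive_sqr_pt t; have id := is_derive_id_pt t.
have du := is_deriveMl_pt theta (is_deriveM_pt sq (delta_derive ht)).
have dam := is_deriveD_pt (is_deriveM_pt id al) (is_deriveMl_pt (alpha - 1) ar).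
have dm := is_deriveD_pt (is_deriveD_pt (is_deriveM_pt sq ll)
  (is_deriveM_pt (is_deriveMl_pt (2 * (alpha - 1)) id) rl))
  (is_deriveMl_pt ((alpha - 1) ^+ 2) rr).
have d1 := is_deriveM_pt (is_deriveM_pt du du) ap.
have d2 := is_deriveMl_pt 2 (is_deriveM_pt du dam).
apply: is_derive_eq (is_deriveD_pt (is_deriveB_pt d1 d2) dm) _.
rewrite (innerC (ddl t)) !(inner_ddl _ ht) /dpsi /Ap_m /=.
rewrite -/(Ap t) -/(Adx t).
rewrite (innerC (dl t) (r t)) (innerC (Adx t) (Ap t)).
rewrite (innerC (r t) (Ap t)) (innerC (r t) (Adx t)) (innerC (dl t) (Ap t)).
rewrite (innerC (dl t) (Adx t)).
have t0 : t != 0 by rewrite gt_eqF // t_gt0.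
move: '[r t, r t] '[r t, dl t] '[dl t, dl t] '[Ap t, Ap t] '[Ap t, Adx t].
move: '[Ap t, r t] '[Ap t, dl t] '[Adx t, r t] '[Adx t, dl t] (delta t) (ddelta t).
by move=> *; field.
Qed.

Let m_vec t := t *: dl t + (alpha - 1) *: r t.

Let Ap_mE t : Ap_m t = '[Ap t, m_vec t].
Proof. by rewrite /Ap_m /m_vec innerDr !innerZr. Qed.

Let multiplierE t : m_sqr t = '[m_vec t, m_vec t].
Proof.
rewrite /m_sqr /m_vec !(innerDl, innerDr, innerZl, innerZr) (innerC (dl t) (r t)).
move: '[r t, r t] '[r t, dl t] '[dl t, dl t] => a b c; ring.
Qed.

Let CA := (2 * Num.max (psi t1) M0 + 2 * M0) / theta ^+ 2.

(** Where |w| >= |m|, the vector w + m has nonnegative scalar product with w, so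
    psi cannot grow there: psi stays below the maximum of its initial value and
    the bound M0 of |m|^2. *)
Lemma constraint_bound t : t1 <= t ->
  (t ^+ 2 * delta t) ^+ 2 * '[A (p t), A (p t)] <= CA.
Proof.
move=> ht.
have psile : psi t <= Num.max (psi t1) M0.
  apply: (is_derive_barrier ht (fun s hs _ => psi_derive hs)) => [s hs _ hc|].
  - have mm : m_sqr s <= psi s.
      by apply: (le_trans (multiplier_le hs)); apply: le_trans hc; rewrite le_max lexx orbT.
    have u0 : 0 < theta * (s ^+ 2 * delta s).
      by rewrite !mulr_gt0 ?exprn_gt0 ?delta_gt0 // t_gt0.
    have k0 : 0 <= (1 - 2 * theta) * (s * delta s) - theta * (s ^+ 2 * ddelta s).
      have := ler_wpM2l (ltW (t_gt0 hs)) (delta_growth hs).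
      by rewrite expr2; move: (delta s) (ddelta s) => a b; lra.
    rewrite /dpsi mulNr oppr_le0 mulr_ge0 // mulr_ge0 //.
    have h : 0 <= theta * (s ^+ 2 * delta s) *
        (theta * (s ^+ 2 * delta s) * '[Ap s, Ap s] - 2 * Ap_m s).
      by move: mm; rewrite /psi; move: '[_, _] (Ap_m s) (m_sqr s) => a b c; lra.
    rewrite pmulr_rge0 // in h.
    have h2 : 0 <= theta * (s ^+ 2 * delta s) * '[Ap s, Ap s].
      by rewrite mulr_ge0 // ltW.
    by move: h h2; move: (_ * '[_, _]) (Ap_m s) => a b; lra.
  - by rewrite le_max lexx.
have t2 : 0 < theta ^+ 2 by rewrite exprn_gt0.
rewrite /CA ler_pdivlMr // -/(Ap t).
have hm := multiplier_le ht.
have := inner_lincomb_ge0 (Ap t) (m_vec t) (theta * (t ^+ 2 * delta t)) (- 2).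
rewrite -Ap_mE -multiplierE; move: psile hm; rewrite /psi.
move: '[_, _] (Ap_m t) (m_sqr t) (Num.max _ _) => a b c d; lra.
Qed.

Let q t := As (r t).
Let dq t := As (dl t).

Let q_derive t : t1 <= t -> is_derive t 1 q (dq t).
Proof. by move=> ht; apply: is_derive_linear => //; exact: r_derive. Qed.

(** A partial primitive: by the equation for x, - B' contains t delta |q|^2 with
    a coefficient at least 1 / 2. *)
Let B t := theta / 2 * (t ^+ 2 * (delta t * '[q t, q t]))
  + (t * '[q t, dx t] + (alpha - 1) * '[q t, p t]).

Let dB t := - (((1 - theta) * (t * delta t) - theta / 2 * (t ^+ 2 * ddelta t)) * '[q t, q t])
  - t * delta t * '[q t, g t] - beta * (t * delta t) * '[q t, As (Ap t)]
  + t * '[Adx t, dl t] + (alpha - 1) * '[Ap t, dl t].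

Let B_derive t : t1 <= t -> is_derive t 1 B (dB t).
Proof.
move=> ht.
have qq := is_derive_inner (q_derive ht) (q_derive ht).
have qx := is_derive_inner (q_derive ht) (dx_derive ht).
have qp := is_derive_inner (q_derive ht) (p_derive ht).
have sq := is_derive_sqr_pt t; have id := is_derive_id_pt t.
have d1 := is_deriveMl_pt (theta / 2) (is_deriveM_pt sq (is_deriveM_pt (delta_derive ht) qq)).
have d2 := is_deriveD_pt (is_deriveM_pt id qx) (is_deriveMl_pt (alpha - 1) qp).
apply: is_derive_eq (is_deriveD_pt d1 d2) _.
rewrite !(inner_ddx _ ht) /dB -!adjE -/(q t) -/(dq t).
rewrite !(innerC _ (As (dl t))) -/(dq t).
have t0 : t != 0 by rewrite gt_eqF // t_gt0.
move: '[q t, q t] '[q t, As (Ap t)] '[q t, g t] '[q t, dx t] '[q t, p t].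
move: '[dq t, q t] '[dq t, dx t] '[dq t, p t] (delta t) (ddelta t).
by move=> *; field.
Qed.

Let k_vel := (K ^+ 2 + 1) / 2 + (alpha - 1) / 2.
Let N := 2 * beta ^+ 2 * K ^+ 2 * (CA / d0) + (alpha - 1) / 2 * (CA / d0 ^+ 2).

Let CA_ge0 : 0 <= CA.
Proof.
apply: le_trans (constraint_bound (lexx t1)).
by apply: mulr_ge0; [exact: sqr_ge0 | exact: inner_ge0].
Qed.

Let t_ge1 t : t1 <= t -> 1 <= t.
Proof. exact: le_trans. Qed.

Let inner_linear_le (Z W : hilbertType R) (f : Z -> W) (z : Z) :
  (`|f z| <= K * `|z|) -> '[f z, f z] <= K ^+ 2 * '[z, z].
Proof.
move=> h; rewrite !inner_normE -exprMn ler_sqr ?nnegrE //.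
by rewrite mulr_ge0.
Qed.

Let Ap_weighted_le t : t1 <= t -> t * delta t * '[Ap t, Ap t] <= CA / d0 * t ^- 2.
Proof.
move=> ht; have t0 := t_gt0 ht; have d := delta_gt0 ht.
have h := constraint_bound ht.
rewrite ler_pdivlMr ?exprn_gt0 // ler_pdivlMr //.
apply: le_trans h; rewrite -/(Ap t).
have -> : t * delta t * '[Ap t, Ap t] * t ^+ 2 * d0 =
   (t ^+ 3 * (delta t * '[Ap t, Ap t])) * d0 by ring.
have -> : (t ^+ 2 * delta t) ^+ 2 * '[Ap t, Ap t] =
   (t ^+ 3 * (delta t * '[Ap t, Ap t])) * (t * delta t) by ring.
apply: ler_wpM2l.
  apply: mulr_ge0; first by rewrite exprn_ge0 // ltW.
  by apply: mulr_ge0; [exact: ltW | exact: inner_ge0].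
rewrite -[d0]mul1r; apply: ler_pM => //; [exact: ltW | exact: t_ge1 | exact: delta_ge].
Qed.

Let Ap_over_t_le t : t1 <= t -> '[Ap t, Ap t] / t <= CA / d0 ^+ 2 * t ^- 2.
Proof.
move=> ht; have t0 := t_gt0 ht; have d := delta_gt0 ht.
have h := constraint_bound ht.
have -> : '[Ap t, Ap t] / t = t * '[Ap t, Ap t] * t ^- 2.
  by field; rewrite gt_eqF.
apply: ler_wpM2r; first by rewrite invr_ge0 exprn_ge0 // ltW.
rewrite ler_pdivlMr ?exprn_gt0 //.
apply: le_trans h; rewrite -/(Ap t) mulrAC; apply: ler_wpM2r => //.
have -> : (t ^+ 2 * delta t) ^+ 2 = t ^+ 4 * delta t ^+ 2 by ring.
apply: ler_pM; [exact: ltW | exact: sqr_ge0 | | ].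
  by rewrite -[X in X <= _]expr1 ler_weXn2l // t_ge1.
by rewrite ler_sqr ?nnegrE ?(ltW d) ?(ltW d0_gt0) // delta_ge.
Qed.

(** The products with q are absorbed by Young's inequality, each taking an eighth
    of t delta |q|^2; the terms in A p are integrable by constraint_bound and are
    collected in N / t^2. *)
Let dB_le t : t1 <= t -> dB t <= - (t * delta t * '[q t, q t] / 4)
  + 2 * (t * delta t * '[g t, g t])
  + k_vel * (t * ('[dx t, dx t] + '[dl t, dl t])) + N * t ^- 2.
Proof.
move=> ht; have t0 := t_gt0 ht; have d := delta_gt0 ht.
have td : 0 < t * delta t by rewrite mulr_gt0.
have h1 : t * delta t / 2 * '[q t, q t] <=
    ((1 - theta) * (t * delta t) - theta / 2 * (t ^+ 2 * ddelta t)) * '[q t, q t].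
  apply: ler_wpM2r => //.
  have := ler_wpM2l (ltW t0) (delta_growth ht); rewrite expr2.
  by move: (delta t) (ddelta t) => a b; lra.
have h2 : - '[q t, g t] <= '[q t, q t] / 8 + 2 * '[g t, g t].
  have := inner_lincomb_ge0 (q t) (g t) 1 4.
  by move: '[_, _] '[_, _] '[_, _] => a b c; lra.
have h3 : - (beta * '[q t, As (Ap t)]) <=
    '[q t, q t] / 8 + 2 * beta ^+ 2 * K ^+ 2 * '[Ap t, Ap t].
  have := inner_lincomb_ge0 (q t) (As (Ap t)) 1 (4 * beta).
  have := ler_wpM2l (sqr_ge0 beta) (inner_linear_le (As_le (Ap t))).
  by move: '[q t, q t] '[q t, _] '[As _, _] '[Ap t, _] => a b c e; lra.
have h4 : '[Adx t, dl t] <= (K ^+ 2 + 1) / 2 * ('[dx t, dx t] + '[dl t, dl t]).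
  have := inner_lincomb_ge0 (Adx t) (dl t) 1 (- 1).
  have := inner_linear_le (A_le (dx t)); rewrite -/(Adx t).
  have kk : 0 <= K ^+ 2 * '[dl t, dl t] by apply: mulr_ge0 => //; exact: sqr_ge0.
  have := inner_ge0 (dx t); move: kk.
  by move: '[dx t, _] '[Adx t, dl t] '[Adx t, _] '[dl t, _] => a b c e; lra.
have h5 : '[Ap t, dl t] <= t * '[dl t, dl t] / 2 + '[Ap t, Ap t] / t / 2.
  rewrite -(ler_pM2l t0).
  have -> : t * (t * '[dl t, dl t] / 2 + '[Ap t, Ap t] / t / 2) =
    (t ^+ 2 * '[dl t, dl t] + '[Ap t, Ap t]) / 2 by field; rewrite gt_eqF.
  have := inner_lincomb_ge0 (Ap t) (dl t) 1 (- t).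
  by move: '[_, _] '[_, _] '[_, _] => a b c; lra.
have h23 := ler_wpM2l (ltW td) (lerD h2 h3).
have h4' := ler_wpM2l (ltW t0) h4.
have h5' := ler_wpM2l (ltW alpha_gt1) h5.
have h6 := ler_wpM2l (ltac:(by rewrite !mulr_ge0 ?sqr_ge0) : 0 <= 2 * beta ^+ 2 * K ^+ 2)
  (Ap_weighted_le ht).
have h7 := ler_wpM2l (ltac:(by rewrite divr_ge0 // ltW // alpha_gt1) : 0 <= (alpha - 1) / 2)
  (Ap_over_t_le ht).
have h8 : 0 <= (alpha - 1) / 2 * (t * '[dx t, dx t]).
  by apply: mulr_ge0; [rewrite divr_ge0 // ltW | apply: mulr_ge0 => //; exact: ltW].
rewrite /dB /k_vel /N.
move: h1 h23 h4' h5' h6 h7 h8.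
move: ('[Ap t, Ap t] / t) (CA / d0) (CA / d0 ^+ 2) (t ^- 2).
move: '[q t, q t] '[q t, g t] '[g t, g t] '[q t, As (Ap t)] '[Adx t, dl t].
move: '[dx t, dx t] '[dl t, dl t] '[Ap t, dl t] '[Ap t, Ap t] => *.
lra.
Qed.

(** Large enough for k_E E' to absorb the terms in g and in the velocities left
    by B'. *)
Let k_E := 5 * ell / theta + (k_vel + 1) / (xi * theta).

Let k_vel_ge0 : 0 <= k_vel.
Proof.
apply: addr_ge0; last by rewrite divr_ge0 // ltW.
by rewrite divr_ge0 // addr_ge0 // sqr_ge0.
Qed.

Let k_E_ge0 : 0 <= k_E.
Proof.
apply: addr_ge0; first by apply: divr_ge0; [rewrite mulr_ge0 // ltW | exact: ltW].
apply: divr_ge0; first by rewrite addr_ge0.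
by apply: mulr_ge0; exact: ltW.
Qed.

Let N_ge0 : 0 <= N.
Proof.
apply: addr_ge0; apply: mulr_ge0.
- by apply: mulr_ge0; [apply: mulr_ge0 => //; exact: sqr_ge0 | exact: sqr_ge0].
- by apply: divr_ge0 => //; exact: ltW.
- by apply: divr_ge0 => //; exact: ltW.
- by apply: divr_ge0 => //; exact: sqr_ge0.
Qed.

(** The summand N / t has derivative - N / t^2, which cancels the remainder of
    dB_le. *)
Let V t := k_E * E t + B t + N * t^-1.
Let dV t := k_E * dE t + dB t + N * (- 1 / t ^+ 2).

Let V_derive t : t1 <= t -> is_derive t 1 V (dV t).
Proof.
move=> ht.
have t0 : t != 0 by rewrite gt_eqF // t_gt0.
exact: (is_deriveD_pt (is_deriveD_pt (is_deriveMl_pt k_E (E_derive ht)) (B_derive ht))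
  (is_deriveMl_pt N (is_deriveV_pt t0 (is_derive_id_pt t)))).
Qed.

Let dV_le t : t1 <= t -> dV t <= - (4^-1 * (t * delta t * '[q t, q t] +
  t * delta t * '[g t, g t] + t * ('[dx t, dx t] + '[dl t, dl t]))).
Proof.
move=> ht; have t0 := t_gt0 ht; have d := delta_gt0 ht.
have h1 : k_E * dE t <= - (k_E * (theta / (2 * ell)) * (t * delta t * '[g t, g t]) +
    k_E * (xi * theta) * (t * ('[dx t, dx t] + '[dl t, dl t]))).
  apply: (le_trans (ler_wpM2l k_E_ge0 (dE_le ht))).
  by rewrite mulrN mulrDr (mulrA k_E (theta / _)) (mulrA k_E (xi * theta)).
have h2 := dB_le ht.
rewrite /dV mulN1r mulrN.
have gg : 0 <= t * delta t * '[g t, g t].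
  by apply: mulr_ge0 => //; apply: mulr_ge0; exact: ltW.
have vv : 0 <= t * ('[dx t, dx t] + '[dl t, dl t]).
  by apply: mulr_ge0; [exact: ltW | exact: addr_ge0].
have k1 : 5 / 2 <= k_E * (theta / (2 * ell)).
  have -> : k_E * (theta / (2 * ell)) = 5 / 2 + (k_vel + 1) / (xi * (2 * ell)).
    by rewrite /k_E mulrDl; congr (_ + _); field; rewrite ?gt_eqF.
  rewrite lerDl; apply: divr_ge0; first by rewrite addr_ge0.
  by rewrite !mulr_ge0 // ltW.
have k2 : k_vel + 1 <= k_E * (xi * theta).
  have -> : k_E * (xi * theta) = 5 * ell * xi + (k_vel + 1).
    by rewrite /k_E mulrDl; congr (_ + _); field; rewrite ?gt_eqF.
  by rewrite lerDr !mulr_ge0 // ltW.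
have h3 := ler_wpM2r gg k1.
have h4 := ler_wpM2r vv k2.
move: h1 h2 h3 h4 gg vv.
move: (dE t) (dB t) (k_E * (theta / _)) (k_E * (xi * theta)) k_vel => a b k1' k2' k3.
move: (t * delta t * '[q t, q t]) (t * delta t * '[g t, g t]) => c f.
move: (t * (_ + _)) (N * t ^- 2) => u n.
move: (k_E * a) (k1' * f) (k2' * u) => w y z *.
lra.
Qed.

Let M := alpha / 2 * ((K ^+ 2 + 1) * B0).

Let V_ge t : t1 <= t -> - M <= V t.
Proof.
move=> ht; have t0 := t_gt0 ht; have d := delta_gt0 ht.
have [hp hr hx _] := trajectory_bounded ht.
have e0 : 0 <= k_E * E t.
  apply: mulr_ge0 => //; apply: le_trans (E_ge ht).
  apply: mulr_ge0; first by rewrite divr_ge0 // ltW.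
  exact: addr_ge0.
have n0 : 0 <= N * t^-1 by apply: mulr_ge0 => //; rewrite invr_ge0 ltW.
have b0 : 0 <= theta / 2 * (t ^+ 2 * (delta t * '[q t, q t])).
  apply: mulr_ge0; first by rewrite divr_ge0 // ltW.
  apply: mulr_ge0; first exact: sqr_ge0.
  by apply: mulr_ge0 => //; exact: ltW.
have hq : '[q t, q t] <= K ^+ 2 * B0.
  apply: (le_trans (inner_linear_le (As_le (r t)))).
  by apply: ler_wpM2l => //; exact: sqr_ge0.
have h1 : - ((K ^+ 2 + 1) * B0) / 2 <= t * '[q t, dx t].
  have := inner_lincomb_ge0 (q t) (dx t) 1 t.
  move: hq hx; move: '[_, _] '[_, _] '[_, _] => a b c; lra.
have h2 : - ((K ^+ 2 + 1) * B0) / 2 <= '[q t, p t].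
  have := inner_lincomb_ge0 (q t) (p t) 1 1.
  move: hq hp; move: '[_, _] '[_, _] '[_, _] => a b c; lra.
have h3 := ler_wpM2l (ltW alpha_gt1) h2.
rewrite /V /B /M; move: e0 n0 b0 h1 h3.
move: (k_E * _) (N * _) (theta / 2 * _) (t * '[_, _]) ((alpha - 1) * '[_, _]) => a b c e f.
lra.
Qed.

Let kappa := (1 - 2 * theta) / theta.

Let kappa_ge0 : 0 <= kappa.
Proof.
apply: divr_ge0; last exact: ltW.
by have := theta_lt; lra.
Qed.

Let growth t : t1 <= t -> t * ddelta t <= kappa * delta t.
Proof.
by move=> ht; rewrite /kappa mulrAC ler_pdivlMr // mulrC; exact: delta_growth.
Qed.

Let quarter_gt0 : 0 < 4^-1 :> R. Proof. by rewrite invr_gt0. Qed.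

Lemma primal_rate e : 0 < e -> exists2 T, t1 <= T &
  forall t, T <= t -> t * Num.sqrt (delta t) * `|g t| ^+ 2 <= e.
Proof.
have t10 : 0 < t1 by exact: lt_le_trans t1_ge1.
apply: (@dissipation_rate R X X delta ddelta V dV g p dx t1 d0 kappa 4^-1 ell M)
  => // [|t ht]; first exact: ltW.
- apply: (le_trans (dV_le ht)); rewrite lerN2 ler_wpM2l // -!inner_normE.
  have tt := ltW (t_gt0 ht); have dd := ltW (delta_gt0 ht).
  have qq : 0 <= t * delta t * '[q t, q t] by apply: mulr_ge0 => //; exact: mulr_ge0.
  have ll : 0 <= t * '[dl t, dl t] by apply: mulr_ge0.
  by rewrite mulrDr; lra.
Qed.

Lemma dual_rate e : 0 < e -> exists2 T, t1 <= T &
  forall t, T <= t -> t * Num.sqrt (delta t) * `|As (r t)| ^+ 2 <= e.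
Proof.
have t10 : 0 < t1 by exact: lt_le_trans t1_ge1.
apply: (@dissipation_rate R X Y delta ddelta V dV q r dl t1 d0 kappa 4^-1 K M)
  => // [s t|t ht].
- by rewrite /q -linearB.
- apply: (le_trans (dV_le ht)); rewrite lerN2 ler_wpM2l // -!inner_normE.
  have tt := ltW (t_gt0 ht); have dd := ltW (delta_gt0 ht).
  have gg : 0 <= t * delta t * '[g t, g t] by apply: mulr_ge0 => //; exact: mulr_ge0.
  have xx : 0 <= t * '[dx t, dx t] by apply: mulr_ge0.
  by rewrite mulrDr; lra.
Qed.

Lemma primal_dual_rates :
  [/\ forall e, 0 < e -> exists T, forall t, T <= t ->
        t * Num.sqrt (delta t) * `|g t| ^+ 2 <= e,
      forall e, 0 < e -> exists T, forall t, T <= t ->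
        t * Num.sqrt (delta t) * `|As (r t)| ^+ 2 <= e &
      exists C, forall t, t1 <= t -> t ^+ 2 * delta t * `|A (p t)| <= C].
Proof.
split.
- by move=> e /primal_rate [T _ ?]; exists T.
- by move=> e /dual_rate [T _ ?]; exists T.
- exists (Num.sqrt CA) => t ht.
  have t0 : 0 <= t ^+ 2 * delta t by rewrite mulr_ge0 ?sqr_ge0 // ltW // delta_gt0.
  have l0 : 0 <= t ^+ 2 * delta t * `|A (p t)| by rewrite mulr_ge0.
  rewrite -ler_sqr ?nnegrE ?sqrtr_ge0 //.
  by rewrite sqr_sqrtr // exprMn -inner_normE constraint_bound.
Qed.

End PrimalDualEnergy.

(** * Gradients of the Lagrangian and Landau notation *)
Lemma gradient_add_affine (R : realType) (X : hilbertType R) (f : X -> R) (x c : X) (k : R) :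
  differentiable f x ->
  gradient (fun z => f z + ('[c, z] + k)) x = gradient f x + c.
Proof.
move=> df.
have cc : continuous (inner c : X -> R).
  apply: (@bounded_linear_continuous _ _ _ (inner c)).
  apply/linear_boundedP; exists `|c|; split; first exact: num_real.
  move=> M cM z; apply: (le_trans (CauchySchwarz_inner _ _)).
  by rewrite ler_wpM2r // ltW.
have dc : differentiable (inner c : X -> R) x.
  exact: linear_differentiable.
have H1 : is_diff x (inner c : X -> R) (inner c).
  by apply: DiffDef => //; exact: diff_lin.
have H := is_diffD (differentiableP df) (is_diffD H1 (is_diff_cst k x)).
have -> : (fun z => f z + ('[c, z] + k)) = f + ((inner c : X -> R) + cst k) by [].
apply: gradient_eq; first exact: ex_diff.
move=> h; rewrite (@diff_val _ _ _ _ _ _ _ H) innerDl -(gradientP df).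
by congr (_ + _); exact: addr0.
Qed.

Lemma gradient_cst (R : realType) (X : hilbertType R) (k : R) (x : X) :
  gradient (fun _ : X => k) x = 0.
Proof.
apply: gradient_eq; first exact: differentiable_cst.
by move=> h; rewrite diff_cst inner0l.
Qed.

(** The square of sqrt(t) delta^(1/4) is t sqrt(delta). *)
Lemma weight_rate (R : realType) (d t h e : R) : 0 < t -> 0 < d -> 0 <= e -> 0 <= h ->
  t * Num.sqrt d * h ^+ 2 <= e ^+ 2 ->
  `|h| <= e * `|(Num.sqrt t * d `^ 4^-1)^-1|.
Proof.
move=> t0 d0 e0 h0.
have p0 : 0 < Num.sqrt t * d `^ 4^-1 by rewrite mulr_gt0 ?sqrtr_gt0 ?powR_gt0.
have -> : t * Num.sqrt d = (Num.sqrt t * d `^ 4^-1) ^+ 2.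
  rewrite exprMn sqr_sqrtr ?(ltW t0) // -powR12_sqrt ?(ltW d0) //.
  by rewrite expr2 -powRD ?(gt_eqF d0) ?implybT //; congr (_ * _ `^ _); lra.
rewrite -exprMn => hle.
have wh : (Num.sqrt t * d `^ 4^-1) * h <= e.
  by rewrite -ler_sqr ?nnegrE // mulr_ge0 // ltW.
by rewrite ger0_norm // ger0_norm ?invr_ge0 ?(ltW p0) // ler_pdivlMr // mulrC.
Qed.

Lemma littleo_weighted (R : realType) (delta h : R -> R) (t1 : R) :
  0 < t1 -> (forall t, t1 <= t -> 0 < delta t) -> (forall t, 0 <= h t) ->
  (forall e, 0 < e -> exists T, forall t, T <= t ->
     t * Num.sqrt (delta t) * h t ^+ 2 <= e) ->
  h =o_ (pinfty_nbhs R) (fun t => (Num.sqrt t * delta t `^ 4^-1)^-1).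
Proof.
move=> t10 d0 h0 H; apply/eqoP => e e0.
have [T HT] := H _ (exprn_gt0 2 e0).
near=> t.
have t1t : t1 <= t by near: t; apply: nbhs_pinfty_ge; rewrite num_real.
have Tt : T <= t by near: t; apply: nbhs_pinfty_ge; rewrite num_real.
apply: (weight_rate (lt_le_trans t10 t1t) (d0 _ t1t) (ltW e0)) => //; exact: HT.
Unshelve. all: by end_near. Qed.

Lemma bigO_weighted (R : realType) (delta h : R -> R) (t1 C : R) :
  0 < t1 -> (forall t, t1 <= t -> 0 < delta t) -> (forall t, 0 <= h t) ->
  (forall t, t1 <= t -> t ^+ 2 * delta t * h t <= C) ->
  h =O_ (pinfty_nbhs R) (fun t => (t ^+ 2 * delta t)^-1).
Proof.
move=> t10 d0 h0 H; apply/eqO_exP; exists (`|C| + 1); first by rewrite ltr_wpDl.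
near=> t.
have t1t : t1 <= t by near: t; apply: nbhs_pinfty_ge; rewrite num_real.
have p0 : 0 < t ^+ 2 * delta t.
  by rewrite mulr_gt0 ?d0 // exprn_gt0 // (lt_le_trans t10).
rewrite [`|h t|]ger0_norm // [`|_^-1|]ger0_norm ?invr_ge0 ?(ltW p0) //.
rewrite ler_pdivlMr // mulrC.
by apply: (le_trans (H _ t1t)); rewrite (le_trans (ler_norm _)) // lerDl.
Unshelve. all: by end_near. Qed.

Lemma is_derive_subr_const (R : realType) (V : normedModType R) (u : R -> V) (c : V)
    (t : R) (du : V) :
  is_derive t 1 u du -> is_derive t 1 (fun s => u s - c) du.
Proof.
move=> ud; have := is_deriveB ud (is_derive_cst c t 1).
by rewrite subr0.
Qed.

(** * The rates along the trajectory *)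
Theorem theorem4p7 (R : realType) (X Y : hilbertType R)
    (f : X -> R) (A : {linear X -> Y}) (b : Y)
    (t0 alpha theta beta ell : R) (delta : R -> R)
    (x0 : X) (lam0 : Y) (dx0 : X) (dlam0 : Y)
    (x : R -> X) (lam : R -> Y) (xs : X) (lams : Y) :
  let D : set R := `[t0, +oo[%classic in
  let L := lagrangian f A b in
  let rate : R -> R := fun t => (Num.sqrt t * delta t `^ 4^-1)^-1 in
  @convex_function R X setT f ->
  (forall z, differentiable f z) ->
  continuous (gradient f) ->
  continuous A ->
  0 < t0 ->
  0 < ell ->
  ell.-lipschitz (gradient f) ->
  (forall t, t0 <= t -> 0 < delta t) ->
  C1_on D delta ->
  {in D &, nondecreasing_fun delta} ->
  3 < alpha ->
  0 <= beta ->
  (alpha - 1)^-1 < theta ->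
  theta < 2^-1 ->
  (ereal_sup [set (t * derive_in D delta t / delta t)%:E | t in D]
    < ((1 - 2 * theta) / theta)%:E)%E ->
  DS_solution f A b t0 alpha theta beta delta x0 lam0 dx0 dlam0 x lam ->
  saddle_points f A b (xs, lams) ->
  [/\ (fun t => `|gradient f (x t) - gradient f xs|) =o_ (pinfty_nbhs R) rate,
      (fun t => `|adjoint A (lam t - lams)|) =o_ (pinfty_nbhs R) rate,
      (forall t, t0 <= t ->
         `|gradient (fun z => L z (lam t)) (x t)|
         = `|gradient f (x t) + adjoint A (lam t)|) /\
      (fun t => `|gradient (fun z => L z (lam t)) (x t)|) =o_ (pinfty_nbhs R) rate &
      (forall t, t0 <= t ->
         `|gradient (fun mu => L (x t) mu) (lam t)| = `|A (x t) - b|) /\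
      (fun t => `|gradient (fun mu => L (x t) mu) (lam t)|)
        =O_ (pinfty_nbhs R) (fun t => (t ^+ 2 * delta t)^-1)].

Proof.
move=> D L rate fconv fdiff _ Ac t00 ell0 lip dpos dC1 dmono al3 be0 th1 th2 hsup sol sp.
have lip' u v : `|gradient f u - gradient f v| <= ell * `|u - v|.
  exact: (lip (u, v)).
have [KKT1 KKT2] := saddle_point_KKT fdiff Ac ell0 lip' sp.
have [K K0 AK] := continuous_linear_le Ac.
have AsK := adjoint_bounded Ac (ltW K0) AK.
(* the adjoint is linear, so that derivatives pass through it *)
pose As_lin := GRing.isLinear.Build _ _ _ _ (adjoint A) (adjoint_is_linear Ac).
pose As : {linear Y -> X} := HB.pack (adjoint A) As_lin.
have AsE : As =1 adjoint A by [].
have Asc : continuous As.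
  apply/bounded_linear_continuous/linear_boundedP; exists K; split; first exact: num_real.
  move=> M KM z; apply: (le_trans (AsK z)); by rewrite ler_wpM2r // ltW.
have adjE u y : '[u, As y] = '[A u, y] by rewrite adjointP.
have th0 : 0 < theta by apply: lt_trans th1; rewrite invr_gt0; lra.
have xi0 : 0 < alpha * theta - theta - 1.
  have a1 : 0 < alpha - 1 by lra.
  by move: th1; rewrite -(ltr_pM2l a1) divff ?gt_eqF //; lra.
(* t1 > t0 avoids the one-sided derivative at t0, and t1 >= 1 allows t to be
   bounded below by 1 in the estimates *)
pose t1 := t0 + 1.
have t0t t : t1 <= t -> t0 < t by apply: lt_le_trans; rewrite ltrDl.
have t11 : 1 <= t1 by rewrite lerDr ltW.
have inD t : t0 <= t -> t \in D by move=> ht; rewrite inE /D /= in_itv /= ht.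
have dge t : t1 <= t -> delta t0 <= delta t.
  move=> ht; have h := ltW (t0t _ ht); apply: dmono => //; exact: inD.
have [[xC1 dxC1] [lC1 dlC1] eqx eql _] := sol.
have der (V : normedModType R) (u : R -> V) t : C1_on D u -> t1 <= t ->
    is_derive t 1 u (derive_in D u t).
  move=> [h _] ht; apply: derive_inE; first exact: t0t.
  by apply: h; rewrite /D /= in_itv /= andbT; exact/ltW/t0t.
pose dx := derive_in D x; pose dl := derive_in D lam.
have growth t : t1 <= t ->
    theta * (t * derive_in D delta t) <= (1 - 2 * theta) * delta t.
  move=> ht; have h := ltW (t0t _ ht); have d := dpos _ h.
  have : ((t * derive_in D delta t / delta t)%:E < ((1 - 2 * theta) / theta)%:E)%E.
    apply: le_lt_trans hsup; apply: ereal_sup_ubound; exists t => //.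
    by rewrite /D /= in_itv /= h.
  by rewrite lte_fin ltr_pdivrMr // mulrAC ltr_pdivlMr // mulrC => /ltW.
pose p t := x t - xs; pose r t := lam t - lams.
pose g t := gradient f (x t) - gradient f xs.
pose Br t := f (x t) - f xs - '[gradient f xs, x t - xs].
have p_derive t : t1 <= t -> is_derive t 1 p (dx t).
  by move=> ht; apply: is_derive_subr_const; exact: der.
have Br_derive t : t1 <= t -> is_derive t 1 Br '[g t, dx t].
  move=> ht; have fx := is_derive_gradient (fdiff (x t)) (der _ _ _ xC1 ht).
  have pg := is_derive_inner (is_derive_cst (gradient f xs) t 1) (p_derive _ ht).
  apply: is_derive_eq (is_deriveB_pt (is_derive_subr_const (f xs) fx) pg) _.
  by rewrite inner0l add0r -innerBl.
have Br_ge0 t : 0 <= Br t.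
  have h := convex_gradient_le (x t) fconv (fdiff xs).
  by rewrite /Br -addrA -opprD subr_ge0.
have coco t : Br t + '[g t, g t] / (2 * ell) <= '[g t, p t].
  exact: convex_gradient_cocoercive.
have gE t : gradient f (x t) + adjoint A lams = g t.
  by rewrite /g; congr (_ + _); apply/eqP; rewrite -subr_eq0 opprK addrC KKT1.
have pE t : A (x t) - b = A (p t) by rewrite /p linearB KKT2.
have ddxE t : t1 <= t -> derive_in D dx t = - ((alpha / t) *: dx t) -
    delta t *: (g t + As (r t + (theta * t) *: dl t) + beta *: As (A (p t))).
  move=> ht; have := eqx t (ltW (t0t _ ht)).
  have -> : lam t + (theta * t) *: derive_in D lam t =
      lams + (r t + (theta * t) *: dl t) by rewrite addrA /r addrCA subrr addr0.
  rewrite -!AsE linearD -pE -gE !AsE -(scalerA (delta t) beta) => /eqP.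
  rewrite -!addrA addr_eq0 => /eqP ->.
  rewrite opprD; congr (_ + _); congr (- _); rewrite -!scalerDr.
  by rewrite !addrA.
have ddlE t : t1 <= t -> derive_in D dl t = - ((alpha / t) *: dl t) +
    delta t *: A (p t + (theta * t) *: dx t).
  move=> ht; have := eql t (ltW (t0t _ ht)).
  have -> : A (x t + (theta * t) *: derive_in D x t) - b = A (p t + (theta * t) *: dx t).
    by rewrite (linearD A (x t)) (linearD A (p t)) -pE addrAC.
  by move/eqP; rewrite subr_eq0 addrC => /eqP <-; rewrite addKr.
have g_lip s t : `|g s - g t| <= ell * `|p s - p t|.
  rewrite /g /p.
  have -> : gradient f (x s) - gradient f xs - (gradient f (x t) - gradient f xs) =
    gradient f (x s) - gradient f (x t) by rewrite opprB addrA subrK.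
  have -> : x s - xs - (x t - xs) = x s - x t by rewrite opprB addrA subrK.
  exact: lip'.
have r_derive t : t1 <= t -> is_derive t 1 r (dl t).
  by move=> ht; apply: is_derive_subr_const; exact: der.
have [R1 R2 [C R3]] := @primal_dual_rates R X Y A As alpha theta beta ell t1 (delta t0) K
  delta (derive_in D delta) Br p dx (derive_in D dx) g r dl (derive_in D dl)
  Ac Asc adjE (ltW K0) AK AsK ell0 be0 th0 th2 xi0 t11 (dpos _ (lexx _)) dge
  (fun t ht => der _ _ _ dC1 ht) growth p_derive (fun t ht => der _ _ _ dxC1 ht)
  r_derive (fun t ht => der _ _ _ dlC1 ht) Br_derive Br_ge0 coco g_lip ddxE ddlE.
have t10 : 0 < t1 by exact: lt_le_trans t11.
have dpos1 t : t1 <= t -> 0 < delta t by move=> ht; exact/dpos/ltW/t0t.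
have o1 : (fun t => `|gradient f (x t) - gradient f xs|) =o_ (pinfty_nbhs R) rate.
  exact: (littleo_weighted t10 dpos1 (fun t => normr_ge0 _) R1).
have o2 : (fun t => `|adjoint A (lam t - lams)|) =o_ (pinfty_nbhs R) rate.
  exact: (littleo_weighted t10 dpos1 (fun t => normr_ge0 _) R2).
have grad1 t : gradient (fun z => L z (lam t)) (x t) = gradient f (x t) + adjoint A (lam t).
  have -> : (fun z => L z (lam t)) =
      (fun z => f z + ('[adjoint A (lam t), z] + - '[lam t, b])).
    apply/funext => z; rewrite /L /lagrangian innerBr; congr (_ + (_ - _)).
    by rewrite innerC adjointP // innerC.
  exact: gradient_add_affine.
have grad2 t : gradient (fun mu => L (x t) mu) (lam t) = A (x t) - b.
  have -> : (fun mu => L (x t) mu) =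
      (fun mu => (fun _ => f (x t)) mu + ('[A (x t) - b, mu] + 0)).
    by apply/funext => mu; rewrite /L /lagrangian addr0 innerC.
  by rewrite gradient_add_affine // gradient_cst add0r.
split => //; split.
- by move=> t _; rewrite grad1.
- have -> : (fun t => `|gradient (fun z => L z (lam t)) (x t)|) =
      (fun t => `|g t + As (r t)|).
    apply/funext => t; rewrite grad1 -gE -addrA -!AsE -linearD /r addrCA subrr addr0.
    by [].
  apply: (littleo_weighted t10 dpos1) => // e e0.
  have e4 : 0 < e / 4 by rewrite divr_gt0.
  have [T1 H1] := R1 _ e4; have [T2 H2] := R2 _ e4.
  exists (Num.max t1 (Num.max T1 T2)) => t; rewrite !ge_max => /and3P [h0 h1 h2].
  have := lerD (H1 _ h1) (H2 _ h2).
  have w0 : 0 <= t * Num.sqrt (delta t).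
    by rewrite mulr_ge0 ?sqrtr_ge0 // (le_trans _ h0) // ltW.
  have : `|g t + As (r t)| ^+ 2 <= 2 * (`|g t| ^+ 2 + `|As (r t)| ^+ 2).
    have : `|g t + As (r t)| ^+ 2 <= (`|g t| + `|As (r t)|) ^+ 2.
      by rewrite ler_sqr ?nnegrE ?addr_ge0 // ler_normD.
    by have := sqr_ge0 (`|g t| - `|As (r t)|); lra.
  move/(ler_wpM2l w0); lra.
- by move=> t _; rewrite grad2.
- have -> : (fun t => `|gradient (fun mu => L (x t) mu) (lam t)|) = (fun t => `|A (p t)|).
    by apply/funext => t; rewrite grad2 pE.
  exact: (@bigO_weighted _ delta _ t1 C).
Qed.
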